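(* Let $G$ be an $(n,d,\lambda)$-graph with $\lambda<d/500$ and $n$ sufficiently large. Let $l\ge 2000\lambda n/d$ and let $\mathcal{F}$ be an $\left(\frac{l}{100\log n},l,500\lambda\right)$-good collection of paths on $V(G)$. Then the graph $G\cup\mathcal{F}$ (obtained from $G$ by adding all edges of the paths and cycles of $\mathcal{F}$) contains a Hamilton cycle.
   Context: An $(n,d,\lambda)$-graph is an $n$-vertex $d$-regular graph whose second largest eigenvalue in absolute value is at most $\lambda$. Given a path $P$ and vertex-disjoint cycles $\mathcal{C}=\{C_1,\dots,C_l\}$, $P$ connects $\mathcal{C}$ if there are edges $e_i\in E(C_i)$ such that $P$ contains every $e_i$ and is disjoint from all other vertices of each $C_i$. Then for each $i$, $x^P_i,y^P_i$ denote the vertices of $C_i$ not incident to $e_i$ that are closest to $e_i$ along $C_i$ on either side (so $x^P_i=y^P_i$ if $C_i$ is a triangle); the flexible set is $V_{P,\mathcal{C}}=\{x^P_i,y^P_i:1\le i\le l\}$. A collection of vertex-disjoint paths on $V(G)$ is $(r,l,\delta)$-good (with respect to $G$) if it consists of at most $r$ paths $P_1,\dots,P_{r'}$ such that: (1) $P_1$ connects a collection $\mathcal{C}$ of $l$ vertex-disjoint cycles which are disjoint from $P_2,\dots,P_{r'}$, and these paths together with $\mathcal{C}$ cover all of $V(G)$; (2) $V_{P_1,\mathcal{C}}$ induces in $G$ a graph of minimum degree at least $\delta$; (3) each endpoint of each path $P_1,\dots,P_{r'}$ has at least $\delta$ neighbours in $G$ inside $V_{P_1,\mathcal{C}}$.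 Such a collection is regarded as including the cycles of $\mathcal{C}$. *)

(* Defs.v *)
From HB Require Import structures.
From mathcomp Require Import all_boot all_order all_algebra.
From mathcomp Require Import reals exp.
Set Implicit Arguments. Unset Strict Implicit. Unset Printing Implicit Defensive.
Import Order.TTheory GRing.Theory Num.Theory.
Local Open Scope ring_scope.

Section Defs.
Variable R : realType.
Variable T : finType.

Definition adjmx (e : rel T) : 'M[R]_#|T| :=
  \matrix_(i, j) (e (enum_val i) (enum_val j))%:R.

Definition ndl_graph (e : rel T) (d : nat) (lam : R) : Prop :=
  [/\ symmetric e, irreflexive e,
      (forall v, #|[set u | e v u]| = d) &
      exists s : seq R,
        [/\ sorted >=%R s,
            char_poly (adjmx e) = \prod_(x <- s) ('X - x%:P) &
            forall i, (0 < i < size s)%N -> `|nth 0 s i| <= lam]].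

Definition pedge (p : seq T) (a b : T) : bool :=
  ((a, b) \in zip p (behead p)) || ((b, a) \in zip p (behead p)).

Definition cedge (c : seq T) (a b : T) : bool :=
  ((a, b) \in zip c (rot 1 c)) || ((b, a) \in zip c (rot 1 c)).

(* P connects the cycle c through its edge {a,b}, and (x,y) are the
   vertices of c not incident to {a,b} closest to it on either side *)
Definition flex_ok (P c : seq T) (x y : T) : Prop :=
  exists (i : nat) (a b z : T) (s : seq T),
    [/\ rot i c = [:: a, b, z & s], pedge P a b,
        (forall v, v \in c -> v \in P -> v = a \/ v = b),
        x = last z s & y = z].

Definition connects (P : seq T) (Cs : seq (seq T)) (X : {set T}) : Prop :=
  exists F : seq (T * T),
    [/\ size F = size Cs,
        (forall cf, cf \in zip Cs F -> flex_ok P cf.1 cf.2.1 cf.2.2) &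
        X = [set v | has (fun p => (p.1 == v) || (p.2 == v)) F]].

Definition good (e : rel T) (r : R) (l : nat) (delta : R)
    (Ps Cs : seq (seq T)) : Prop :=
  exists (P1 : seq T) (Ps' : seq (seq T)),
    [/\ Ps = P1 :: Ps',
        (size Ps)%:R <= r,
        size Cs = l &
        all (fun p => p != [::]) Ps] /\
    [/\ uniq (flatten Ps),
        uniq (flatten Cs),
        all (fun c => 2 < size c)%N Cs,
        (forall v, v \in flatten Cs -> v \notin flatten Ps') &
        (forall v, (v \in flatten Ps) || (v \in flatten Cs))] /\
    exists X : {set T},
      [/\ connects P1 Cs X,
          (forall x, x \in X -> delta <= #|[set y in X | e x y]|%:R) &
          (forall p, p \in Ps -> forall v, (v == head v p) || (v == last v p) ->
              v \in p -> delta <= #|[set y in X | e v y]|%:R)].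

Definition unionG (e : rel T) (Ps Cs : seq (seq T)) : rel T :=
  fun a b => [|| e a b, has (fun p => pedge p a b) Ps | has (fun c => cedge c a b) Cs].

Definition hamiltonian (g : rel T) : Prop :=
  exists h : seq T, [/\ uniq h, (forall v, v \in h), (2 < size h)%N & cycle g h].

End Defs.

(* Main.v *)
Require Import Defs.
From HB Require Import structures.
From mathcomp Require Import all_boot all_order all_algebra.
From mathcomp Require Import reals exp.
From mathcomp Require Import ring lra zify.
From mathcomp.real_closed Require Import complex.
Set Implicit Arguments. Unset Strict Implicit. Unset Printing Implicit Defensive.
Import Order.TTheory GRing.Theory Num.Theory.

(**
Each path endpoint, or flexible vertex, [v] can be prolonged through an unused
cycle: if [v] is adjacent to one of the two flexible vertices of a cycle, walk
around the cycle (avoiding the edge lying on [P1]) to its other flexible vertex,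
which again has many flexible neighbours.  By the expander mixing lemma every
small set [A] of such vertices is adjacent to at least [4 |A|] cycles.  Hence,
by a Friedman-Pippenger argument in which the children of a vertex are cycles,
one can grow from each of two endpoints a binary tree of logarithmic depth with
more than [lam n / d] leaves; some edge of [G] joins the two sets of leaves.
Keeping only the two branches ending in that edge and giving all other cycles
back preserves the extendability condition, so that the end of each path can be
linked in turn to the beginning of the next one, cyclically.  At most
[O(r log n) < l] cycles are used; the others are absorbed into [P1] by replacing
the edge [e_i] with the rest of the cycle.
*)

(** * Friedman-Pippenger extension with cycles as children *)

Section Linking.
Variables (T I : finType) (g : T -> I -> bool) (Y : {set T}) (m M : nat).
Implicit Types (par : {ffun I -> option T}) (A B : {set T}).

Definition cnbr A : {set I} := [set c | [exists v in A, g v c]].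

(* [par c = Some v] means that the cycle [c] is a child of [v].  Counting the
   children that [A] already has makes [extendable] stable under giving cycles
   back, whatever their parents. *)
Definition reserved par A : {set I} :=
  [set c | if par c is Some v then v \in A else c \in cnbr A].

Definition used par : {set I} := [set c | par c != None].
Definition kids par v : {set I} := [set c | par c == Some v].

(** A Hall-type condition of multiplicity four: a vertex keeps at most two children from finished
    links, and growing a binary tree from it temporarily adds two more. *)
Definition extendable par : bool :=
  [forall A : {set T}, (A \subset Y) && (#|A| <= 2 * m) ==>
     (4 * #|A| <= #|reserved par A|)].

Definition add_child par c v : {ffun I -> option T} :=
  [ffun x => if x == c then Some v else par x].

Lemma extendableP par :
  reflect (forall A, A \subset Y -> #|A| <= 2 * m -> 4 * #|A| <= #|reserved par A|)
          (extendable par).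
Proof.
apply: (iffP forallP) => [H A sA cA|H A]; first by have := H A; rewrite sA cA.
by apply/implyP => /andP[]; apply: H.
Qed.

Lemma cnbrS A B : A \subset B -> cnbr A \subset cnbr B.
Proof.
move=> /subsetP AB; apply/subsetP => c; rewrite !inE => /exists_inP[v vA gv].
by apply/exists_inP; exists v; first exact: AB.
Qed.

Lemma cnbrU A B : cnbr (A :|: B) = cnbr A :|: cnbr B.
Proof.
apply/eqP; rewrite eqEsubset subUset !cnbrS ?subsetUl ?subsetUr // !andbT.
apply/subsetP => c; rewrite !inE => /exists_inP[v]; rewrite inE => /orP[] vA gv.
  by apply/orP; left; apply/exists_inP; exists v.
by apply/orP; right; apply/exists_inP; exists v.
Qed.

Lemma reservedU par A B :
  reserved par (A :|: B) = reserved par A :|: reserved par B.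
Proof.
apply/setP => c; rewrite inE in_setU ![c \in reserved _ _]inE.
by case: (par c) => [v|]; rewrite ?cnbrU in_setU.
Qed.

(** With [reservedU] this makes [#|reserved par A|] submodular in [A], so that tight sets are closed
    under union. *)
Lemma reservedI par A B :
  reserved par (A :&: B) \subset reserved par A :&: reserved par B.
Proof.
apply/subsetP => c; rewrite inE in_setI ![c \in reserved _ _]inE.
case: (par c) => [v|]; first by rewrite in_setI.
by move=> cAB; rewrite !(subsetP (cnbrS _) _ cAB) ?subsetIl ?subsetIr.
Qed.

Lemma reserved0 par : reserved par set0 = set0.
Proof.
apply/setP => c; rewrite !inE; case: (par c) => [v|]; rewrite ?inE //.
by apply/negbTE/exists_inP => -[v]; rewrite inE.
Qed.

(** A returned cycle was counted only for sets containing its parent; being adjacent to that parent,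
    it is still counted there as a free neighbour. *)
Lemma extendable_sub par par' :
  (forall c v, par c = Some v -> g v c) ->
  (forall c, par' c = None \/ par' c = par c) ->
  extendable par -> extendable par'.
Proof.
move=> gpar sub /extendableP ext; apply/extendableP => A sA cA.
apply: leq_trans (ext A sA cA) _; apply/subset_leq_card/subsetP => c; rewrite !inE.
case: (sub c) => -> //; case pc: (par c) => [v|] // vA.
by apply/exists_inP; exists v => //; apply: gpar.
Qed.

Hypothesis m_gt0 : 0 < m.
Hypothesis cnbr_big :
  forall A, A \subset Y -> m <= #|A| -> #|A| <= 2 * m -> 8 * m + M < #|cnbr A|.

(* Friedman-Pippenger: sets attaining equality in [extendable] have fewer than
   [m] elements and are closed under union; were no child of [v] admissible,
   adding [v] to the union of the obstructing sets would violate [extendable]. *)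
Lemma extendable_add par v :
  extendable par -> #|used par| <= M -> v \in Y -> #|kids par v| < 4 ->
  exists c, [/\ par c = None, g v c & extendable (add_child par c v)].
Proof.
move=> /extendableP ext usedM vY kidsv.
case: (pickP [pred c | [&& par c == None, g v c & extendable (add_child par c v)]]).
  by move=> c /and3P[/eqP pc gv ex]; exists c.
move=> noc.
pose K A := [/\ A \subset Y, #|A| < m, #|reserved par A| <= 4 * #|A| & v \notin A].
(* If [m <= #|A| <= 2 * m], then [cnbr_big] leaves more than [8 * m] neighbouring cycles after the
   at most [M] used ones are discarded, so [A] cannot be tight. *)
have Ksmall A : A \subset Y -> #|A| <= 2 * m -> #|reserved par A| <= 4 * #|A| -> #|A| < m.
  move=> sA cA rA; rewrite ltnNge; apply/negP => mA.
  have := cnbr_big sA mA cA.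
  have : #|cnbr A| <= #|used par| + #|reserved par A|.
    apply: leq_trans (leq_card_setU _ _); apply/subset_leq_card/subsetP => c cA'.
    by rewrite in_setU [c \in reserved _ _]inE [c \in used _]inE; case: (par c).
  lia.
have KU A B : K A -> K B -> K (A :|: B).
  move=> [sA cA rA vA] [sB cB rB vB].
  have sAB : A :|: B \subset Y by rewrite subUset sA.
  have UAB := cardsUI A B; have URAB := cardsUI (reserved par A) (reserved par B).
  have IA : #|A :&: B| <= #|A| by rewrite subset_leq_card ?subsetIl.
  have eI := ext (A :&: B) (subset_trans (subsetIl _ _) sA).
  have rI := subset_leq_card (reservedI par A B).
  have rAB : #|reserved par (A :|: B)| <= 4 * #|A :|: B|.
    rewrite reservedU; have := eI ltac:(lia); lia.
  split=> //; last by rewrite inE negb_or vA.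
  by apply: Ksmall => //; lia.
pose S := \bigcup_(A : {set T} | [&& A \subset Y, #|A| < m,
             #|reserved par A| <= 4 * #|A| & v \notin A]) A.
have [sS cS rS vS] : K S.
  apply: (big_ind K) => // [|A /and4P[*] //].
  by split; rewrite ?sub0set ?cards0 ?reserved0 ?inE ?cards0.
(* Making [c] a child of [v] removes nothing but [c] from a reserved set. Hence a set [A] violating
   the new condition was tight, misses [v] and is adjacent to [c]. *)
have inS c : par c = None -> g v c -> c \in cnbr S.
  move=> pc gv; have := noc c; rewrite /= pc eqxx gv /= => /negbT.
  rewrite negb_forall => /existsP[A]; rewrite negb_imply -ltnNge => /andP[/andP[sA cA] rA].
  have eA := ext A sA cA.
  have notsub : ~~ (reserved par A \subset reserved (add_child par c v) A).
    by apply/negP => /subset_leq_card; lia.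
  have sub' : reserved par A :\ c \subset reserved (add_child par c v) A.
    apply/subsetP => x; rewrite in_setD1 => /andP[/negbTE xc].
    by rewrite !inE ffunE xc.
  have cR : c \in reserved par A.
    apply: contraR notsub => cR; apply: subset_trans sub'.
    by apply/subsetP => x xR; rewrite in_setD1 xR andbT; apply: contraNneq cR => <-.
  have vA : v \notin A.
    apply: contra notsub => vA; apply/subsetP => x xR.
    case: (eqVneq x c) => [->|xc]; first by rewrite inE ffunE eqxx.
    by apply: (subsetP sub'); rewrite in_setD1 xc.
  have := subset_leq_card sub'; have := cardsD1 c (reserved par A); rewrite cR => c1 c2.
  have rA' : #|reserved par A| <= 4 * #|A| by lia.
  have AS : A \subset S by apply: (bigcup_max A) => //; rewrite sA rA' vA Ksmall.
  by apply: (subsetP (cnbrS AS)); move: cR; rewrite inE pc.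
have := ext (v |: S).
rewrite cardsU1 vS subUset sub1set vY sS => /(_ isT) H.
(* All free neighbours of [v] are already neighbours of [S], so [v] contributes only its own
   children, fewer than the four required. *)
have : #|reserved par (v |: S)| <= #|reserved par S| + #|kids par v|.
  apply: leq_trans (leq_card_setU _ _); apply/subset_leq_card/subsetP => c.
  rewrite in_setU ![c \in reserved _ _]inE [c \in kids _ _]inE.
  case pc: (par c) => [w|]; first by rewrite in_setU1 => /orP[/eqP->|->]; rewrite ?eqxx ?orbT.
  rewrite inE => /exists_inP[w]; rewrite in_setU1 => /orP[/eqP->|wS] gw.
    by rewrite inS.
  by apply/orP; left; rewrite inE; apply/exists_inP; exists w.
have := H ltac:(lia); lia.
Qed.

End Linking.

(** * Linking pairs of vertices through disjoint cycles *)

Section Trees.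
Variables (T I : finType) (g : T -> I -> bool) (Y : {set T}) (m M : nat).
(* [own w c]: [w] is a flexible vertex of [c]; [st v c]: the flexible vertex of
   [c] reached when [c] is entered from [v]. *)
Variables (st : T -> I -> T) (own : T -> I -> bool).
Hypothesis m_gt0 : 0 < m.
Hypothesis cnbr_big :
  forall A : {set T}, A \subset Y -> m <= #|A| -> #|A| <= 2 * m -> 8 * m + M < #|cnbr g A|.
Hypothesis own_st : forall v c, own (st v c) c.
Hypothesis own_inj : forall v c c', own v c -> own v c' -> c = c'.
Hypothesis own_Y : forall v c, own v c -> v \in Y.
Implicit Types (par : {ffun I -> option T}).
Local Notation extendable := (extendable g Y m).

(** The field [forest_own] ensures that a vertex reached through a fresh cycle is still childless,
    as [fresh_kids] records, and can serve as a new leaf. *)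
Record forest par : Prop := Forest {
  forest_ext : extendable par;
  forest_nbr : forall c v, par c = Some v -> g v c;
  forest_own : forall c v c', par c = Some v -> own v c' -> c' \in used par }.

Definition settled par v := forall c, own v c -> c \in used par.

(** Two earlier children are tolerated, since two further ones can then be added below the bound
    four of [extendable_add]. *)
Definition node par v := [/\ v \in Y, #|kids par v| <= 2 & settled par v].

Lemma used_add par c v : par c = None -> used (add_child par c v) = c |: used par.
Proof.
by move=> pc; apply/setP => x; rewrite !inE ffunE; case: (eqVneq x c) => //= _.
Qed.

Lemma card_used_add par c v :
  par c = None -> #|used (add_child par c v)| = #|used par|.+1.
Proof. by move=> pc; rewrite used_add // cardsU1 inE pc eqxx. Qed.

Lemma kids_add par c v w : par c = None ->
  kids (add_child par c v) w = if w == v then c |: kids par w else kids par w.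
Proof.
move=> pc; apply/setP => x; rewrite inE ffunE; case: (eqVneq x c) => [->|xc].
  case: (eqVneq w v) => [->|wv]; rewrite !inE ?eqxx // pc.
  by apply/eqP => -[vw]; rewrite vw eqxx in wv.
by case: (w == v); rewrite !inE ?(negbTE xc).
Qed.

Lemma used_mono par par' : (forall c v, par c = Some v -> par' c = Some v) ->
  used par \subset used par'.
Proof.
move=> sub; apply/subsetP => c; rewrite !inE.
by case pc: (par c) => [v|] // _; rewrite (sub _ _ pc).
Qed.

Lemma add_child_mono par c v : par c = None ->
  forall x w, par x = Some w -> add_child par c v x = Some w.
Proof. by move=> pc x w px; rewrite ffunE; case: eqVneq => // xc; rewrite xc pc in px. Qed.

Lemma forest_add par v : forest par -> v \in Y -> settled par v ->
  #|used par| <= M -> #|kids par v| < 4 ->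
  exists c, [/\ par c = None, g v c & forest (add_child par c v)].
Proof.
move=> [ext nbr ow] vY sv uM kv.
have [c [pc gv ext']] := extendable_add m_gt0 cnbr_big ext uM vY kv.
exists c; split=> //; split=> // [x w|x w c']; rewrite ffunE.
  by case: eqVneq => [-> [<-]|_ /nbr].
rewrite used_add // in_setU1.
case: eqVneq => [_ [<-] /sv ->|_ px /(ow _ _ _ px) ->]; exact: orbT.
Qed.

Lemma fresh_kids par w c : forest par -> par c = None -> own w c -> kids par w = set0.
Proof.
move=> F pc wc; apply/setP => x; rewrite !inE; apply/negP => /eqP px.
by have := forest_own F px wc; rewrite inE pc.
Qed.

(** Each leaf in turn receives two fresh cycles. The last clause confines new children to [L], which
    is why the vertices reached are nodes again. *)
Lemma grow_layer par L :
  forest par -> uniq L -> (forall u, u \in L -> node par u) ->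
  #|used par| + 2 * size L <= M ->
  exists par' L',
    [/\ [/\ forest par', (forall c v, par c = Some v -> par' c = Some v) &
             #|used par'| = #|used par| + 2 * size L],
        [/\ uniq L', size L' = 2 * size L & forall u, u \in L' -> node par' u],
        (forall u', u' \in L' ->
           exists u c, [/\ u \in L, par c = None, par' c = Some u & u' = st u c]) &
        (forall w, #|kids par' w| <= #|kids par w| + 2 * (w \in L))].
Proof.
elim: L par => [|u L IH] par F.
  move=> _ _ _; exists par, [::].
  by do !split=> //=; rewrite ?muln0 ?addn0 // => w; lia.
move=> /= /andP[uL unL] nodeL; set b := size L => sizeM.
have [uY ku su] : node par u by apply: nodeL; rewrite mem_head.
have uM : #|used par| < M by lia.
have [c1 [p1 g1 F1]] := forest_add F uY su (ltnW uM) (leqW ku).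
set par1 := add_child par c1 u in F1.
have m1 : forall c v, par c = Some v -> par1 c = Some v by apply: add_child_mono.
have su1 : settled par1 u by move=> c /su; apply: (subsetP (used_mono m1)).
have k1 := kids_add u _ p1; have u1 : #|used par1| = _ := card_used_add u p1.
have kc1 : c1 \notin kids par u by rewrite inE p1.
have ku1 : #|kids par1 u| < 4 by rewrite /par1 k1 eqxx cardsU1 kc1.
have uM1 : #|used par1| <= M by rewrite /par1 u1.
have [c2 [p2 g2 F2]] := forest_add F1 uY su1 uM1 ku1.
set par2 := add_child par1 c2 u in F2.
have m2 : forall c v, par1 c = Some v -> par2 c = Some v by apply: add_child_mono.
have m02 c v : par c = Some v -> par2 c = Some v by move=> /m1/m2.
have k2 := kids_add u _ p2; have u2 : #|used par2| = _ := card_used_add u p2.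
have p12 : c1 != c2 by apply/eqP => e; move: p2; rewrite -e ffunE eqxx.
have p2' : par c2 = None by move: p2; rewrite ffunE eq_sym (negbTE p12).
have su2 := subsetP (used_mono m02).
have kids2 w : w != u -> kids par2 w = kids par w.
  by move=> wu; rewrite /par2 k2 (negbTE wu) k1 (negbTE wu).
have kids2u : #|kids par2 u| <= #|kids par u| + 2.
  rewrite /par2 k2 eqxx k1 eqxx; apply: leq_trans (leq_card_setU _ _) _.
  by rewrite cards1 cardsU1 kc1; lia.
have node2 w : w \in L -> node par2 w.
  move=> wL; have [|wY kw sw] := nodeL w; first by rewrite inE wL orbT.
  split=> //; last by move=> c /sw /su2.
  by rewrite kids2 //; apply: contraNneq uL => <-.
have [] := IH par2 F2 unL node2; first by rewrite u2 u1; lia.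
move=> par' [L' [[F' m' u'] [unL' szL' nodeL'] parL' kids']].
have m0' c v : par c = Some v -> par' c = Some v by move=> /m02/m'.
have used1 : c1 \in used par2 by rewrite inE (m2 _ u) // ffunE eqxx.
have used2 : c2 \in used par2 by rewrite inE ffunE eqxx.
have new c : par c = None -> c \in used par2 ->
    [/\ st u c \notin L', node par' (st u c) & st u c != u].
  move=> pc uc; have stu : st u c != u.
    by apply/eqP => e; have := su c; rewrite -{1}e inE pc => /(_ (own_st _ _)).
  have stL : st u c \notin L.
    apply/negP => sL; have [|_ _ /(_ c (own_st _ _))] := nodeL (st u c).
      by rewrite inE sL orbT.
    by rewrite inE pc.
  split=> //.
    apply/negP => /parL'[v [x [_ px _ e]]].
    have : c = x by apply: own_inj (own_st u c) _; rewrite e.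
    by move=> cx; move: uc; rewrite cx inE px.
  split; first exact: own_Y (own_st u c).
    have := kids' (st u c); rewrite (negbTE stL) kids2 //.
    by rewrite (fresh_kids F pc (own_st u c)) cards0 muln0 leqn0 => /eqP->.
  move=> x /(own_inj (own_st u c)) <-; exact: (subsetP (used_mono m')).
have [n1 N1 _] := new c1 p1 used1; have [n2 N2 _] := new c2 p2' used2.
have st12 : st u c1 != st u c2.
  by apply: contraNneq p12 => e; apply/eqP/(own_inj (own_st u c1)); rewrite e.
exists par', [:: st u c1, st u c2 & L']; split; first split=> //.
- by rewrite u' u2 u1 -addn2 -addnA -mulnS.
- split=> [||w]; rewrite /= ?inE ?negb_or ?st12 ?n1 ?n2 ?szL' ?mulnS //.
  by move=> /or3P[/eqP->|/eqP->|/nodeL'].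
- move=> w; rewrite !inE => /or3P[/eqP->|/eqP->|/parL'[v [c [vL pc p'c ->]]]].
  + by exists u, c1; rewrite mem_head p1 (m' _ u) // (m2 _ u) // ffunE eqxx.
  + by exists u, c2; rewrite mem_head p2' (m' _ u) // ffunE eqxx.
  exists v, c; split=> //; first by rewrite inE vL orbT.
  by case pc': (par c) => [z|] //; rewrite (m02 _ _ pc') in pc.
- move=> w; have := kids' w; rewrite inE; case: (eqVneq w u) => [->|wu] /=.
    by rewrite (negbTE uL) muln0 addn0 => /leq_trans -> //; rewrite muln1.
  by rewrite kids2.
Qed.

Fixpoint walk par v (cs : seq I) : bool :=
  if cs is c :: cs' then (par c == Some v) && walk par (st v c) cs' else true.

Lemma walk_rcons par v cs c : walk par v (rcons cs c) =
  walk par v cs && (par c == Some (foldl st v cs)).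
Proof. by elim: cs v => [|x cs IH] v /=; rewrite ?andbT // IH andbA. Qed.

Lemma walk_mono par par' v cs : (forall c v, par c = Some v -> par' c = Some v) ->
  walk par v cs -> walk par' v cs.
Proof. by move=> sub; elim: cs v => //= c cs IH v /andP[/eqP/sub-> /IH->]; rewrite eqxx. Qed.

Lemma walk_used par v cs : walk par v cs -> {subset cs <= used par}.
Proof.
elim: cs v => [|c cs IH] v //= /andP[/eqP pc /IH sub] x.
by rewrite in_cons => /orP[/eqP->|/sub //]; rewrite inE pc.
Qed.

(** A binary tree of depth [k] uses [2 + 4 + ... + 2 ^ k] cycles, that is [2 ^ k.+1 - 2]; the
    summand 2 is moved across to avoid truncated subtraction. A vertex settled beforehand is not an
    inner node of the new tree unless it is the root, hence the last clause. *)
Lemma grow_tree par v k :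
  forest par -> node par v -> #|used par| + 2 ^ k.+1 <= M + 2 ->
  exists par' L,
    [/\ [/\ forest par', (forall c v, par c = Some v -> par' c = Some v) &
             #|used par'| + 2 = #|used par| + 2 ^ k.+1],
        [/\ uniq L, size L = 2 ^ k & forall u, u \in L -> node par' u],
        (forall u, u \in L -> exists cs, [/\ size cs = k, uniq cs,
           (forall c, c \in cs -> par c = None), walk par' v cs & u = foldl st v cs]) &
        (forall w, settled par w -> #|kids par' w| <= #|kids par w| + 2 * ((w == v) && (0 < k)))].
Proof.
move=> F nv; elim: k => [|k IH] sizeM.
  exists par, [:: v]; split=> //=; first by split=> // u; rewrite inE => /eqP->.
  - by move=> u; rewrite inE => /eqP->; exists [::].
  - by move=> w; rewrite andbF muln0 addn0.
have [|par1 [L [[F1 m1 u1] [unL szL nodeL] walkL kids1]]] := IH.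
  by move: sizeM; rewrite !expnS; move: (2 ^ k) => p; lia.
have [|par2 [L' [[F2 m2 u2] [unL' szL' nodeL'] parL' kids2]]] := grow_layer F1 unL nodeL.
  by rewrite szL; move: u1 sizeM; rewrite !expnS; move: (2 ^ k) => p; lia.
have used1 := subsetP (used_mono m1).
have p01 c : par1 c = None -> par c = None.
  by case pc: (par c) => [x|] //; rewrite (m1 _ _ pc).
exists par2, L'; split.
- split=> //; first by move=> c x /m1/m2.
  by rewrite u2 szL; move: u1; rewrite !expnS; move: (2 ^ k) => p; lia.
- by split=> //; rewrite szL' szL -expnS.
- move=> w /parL'[u [c [uL pc p2c ->]]].
  have [cs [szc unc parc walkc eu]] := walkL u uL.
  exists (rcons cs c); split.
  + by rewrite size_rcons szc.
  + rewrite rcons_uniq unc andbT; apply/negP => cin.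
    by have := walk_used walkc cin; rewrite inE pc.
  + by move=> x; rewrite mem_rcons inE => /orP[/eqP->|/parc //]; apply: p01.
  + by rewrite walk_rcons (walk_mono m2 walkc) -eu p2c eqxx.
  + by rewrite -cats1 foldl_cat /= -eu.
- move=> w sw; apply: leq_trans (kids2 w) _.
  (* A leaf of the previous layer is either the root, when [k = 0], or owns a cycle that was free in
     [par] and so was not settled. *)
  have := kids1 w sw; rewrite andbT; case: (boolP (w \in L)) => wL; last by case: (w == v); lia.
  have [cs [szc _ parc _ eu]] := walkL w wL; case: {+}k szc => [|k'] szc.
    by rewrite (size0nil szc) in eu; rewrite eu eqxx; lia.
  case/lastP: cs eu szc parc => [|cs c] //; rewrite -cats1 foldl_cat /= => eu _ parc.
  have /sw : own w c by rewrite eu.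
  by rewrite inE parc // mem_cat mem_head orbT.
Qed.

(** Only the first cycle of a branch can hang from a root that owns nothing; the others hang from a
    vertex of the branch itself. Keeping a whole branch therefore preserves [forest_own]. *)
Lemma walk_parent par v cs c x : walk par v cs -> c \in cs -> par c = Some x ->
  (ohead cs == Some c) && (x == v) \/ exists2 c', c' \in cs & own x c'.
Proof.
elim: cs v => [|a cs IH] v //= /andP[/eqP pa wcs].
rewrite in_cons => /orP[/eqP->|cin].
  by rewrite pa => -[->]; left; rewrite !eqxx.
move=> pc; right; have [/andP[_ /eqP->]|[c' c'in ow]] := IH _ wcs cin pc.
  by exists a; rewrite ?mem_head.
by exists c'; rewrite // inE c'in orbT.
Qed.

Fixpoint nbr_walk v (cs : seq I) : bool :=
  if cs is c :: cs' then g v c && nbr_walk (st v c) cs' else true.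

Lemma walk_nbr_walk par v cs : forest par -> walk par v cs -> nbr_walk v cs.
Proof.
by move=> F; elim: cs v => //= c cs IH v /andP[/eqP /(forest_nbr F)-> /IH].
Qed.

(** * Linking one pair of endpoints, then all pairs *)

Variables (E : rel T) (k : nat).
Hypothesis E_dense : forall A B : {set T}, A \subset Y -> B \subset Y ->
  m < #|A| -> m < #|B| -> exists u v, [/\ u \in A, v \in B & E u v].
Hypothesis m_lt_2k : m < 2 ^ k.

Definition linked (p : T * T) (q : seq I * seq I) : bool :=
  [&& nbr_walk p.1 q.1, nbr_walk p.2 q.2 & E (foldl st p.1 q.1) (foldl st p.2 q.2)].

(** Models an endpoint of a path: it can start trees but is never reached through a cycle. *)
Definition terminal v := v \in Y /\ forall c, ~~ own v c.

Lemma terminal_settled par v : terminal v -> settled par v.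
Proof. by case=> _ nov c vc; have := nov c; rewrite vc. Qed.

Lemma card_ohead (cs : seq I) : #|[set c | ohead cs == Some c]| <= 1.
Proof.
apply/card_le1_eqP => c c'; rewrite !inE => /eqP-> /eqP[] //.
Qed.

(** The budget [4 * 2 ^ k] pays for both trees; after pruning, only the [2 * k] cycles of two
    branches stay used. If [w = v], the first tree already gives [w] two children, which the
    hypothesis on [w] accounts for. *)
Lemma link_pair par v w :
  forest par -> terminal v -> terminal w -> #|kids par v| <= 2 ->
  #|kids par w| + 2 * (w == v) <= 2 -> #|used par| + 4 * 2 ^ k <= M ->
  exists par' q,
    [/\ [/\ forest par', linked (v, w) q & #|used par'| = #|used par| + 2 * k],
        uniq (q.1 ++ q.2),
        (forall c, c \in q.1 ++ q.2 -> par c = None /\ par' c <> None),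
        (forall c, par c <> None -> par' c <> None) &
        (forall z, terminal z -> #|kids par' z| <= #|kids par z| + (z == v) + (z == w))].
Proof.
move=> F rv rw kv kw sizeM.
have [||par1 [L1 [[F1 m1 u1] [unL1 szL1 nodeL1] walkL1 kids1]]] := @grow_tree par v k F.
- by split=> //; [case: rv | apply: terminal_settled].
- by move: sizeM; rewrite !expnS; move: (2 ^ k) => p; lia.
have nw : node par1 w.
  split; [by case: rw | | exact: terminal_settled].
  apply: leq_trans (kids1 w (terminal_settled _ rw)) (leq_trans _ kw).
  by rewrite leq_add2l leq_mul2l; case: (w == v); case: (0 < k).
have [|par2 [L2 [[F2 m2 u2] [unL2 szL2 nodeL2] walkL2 _]]] := @grow_tree par1 w k F1 nw.
  by move: sizeM u1; rewrite !expnS; move: (2 ^ k) => p; lia.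
have sub1 : [set x in L1] \subset Y by apply/subsetP => x; rewrite inE => /nodeL1[].
have sub2 : [set x in L2] \subset Y by apply/subsetP => x; rewrite inE => /nodeL2[].
have [||u [u' []]] := E_dense sub1 sub2.
- by rewrite cardsE (card_uniqP unL1) szL1.
- by rewrite cardsE (card_uniqP unL2) szL2.
rewrite !inE => /walkL1[cs1 [sz1 un1 new1 walk1 ->]] /walkL2[cs2 [sz2 un2 new2 walk2 ->]] Euu.
have walk1' := walk_mono m2 walk1.
have use1 := walk_used walk1'; have use2 := walk_used walk2.
have m02 c x : par c = Some x -> par2 c = Some x by move=> /m1/m2.
have new2' c : c \in cs2 -> par c = None.
  by move=> /new2 p1; case pc: (par c) => [x|] //; rewrite (m1 _ _ pc) in p1.
have uncs : uniq (cs1 ++ cs2).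
  rewrite cat_uniq un1 un2 andbT; apply/hasPn => c /new2 p1.
  by apply/negP => /(walk_used walk1); rewrite inE p1.
have newcs c : c \in cs1 ++ cs2 -> par c = None.
  by rewrite mem_cat => /orP[/new1|/new2'].
have usecs c : c \in cs1 ++ cs2 -> par2 c <> None.
  by rewrite mem_cat => /orP[/use1|/use2]; rewrite inE => /eqP.
(* All cycles outside the two branches are given back. *)
pose par3 : {ffun I -> option T} :=
  [ffun c => if (c \in cs1 ++ cs2) || (c \in used par) then par2 c else None].
have p3 c x : par3 c = Some x -> par2 c = Some x by rewrite ffunE; case: ifP.
have p3cs c : c \in cs1 ++ cs2 -> par3 c = par2 c by rewrite ffunE => ->.
have p3old c x : par c = Some x -> par3 c = Some x.
  by move=> pc; rewrite ffunE [c \in used _]inE pc orbT (m02 _ _ pc).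
have old3 c x : par3 c = Some x -> c \notin cs1 ++ cs2 -> par c = Some x.
  move=> + cin; rewrite ffunE (negbTE cin) inE /=; case pc: (par c) => [y|] //=.
  by rewrite (m02 _ _ pc).
have used3 c : c \in cs1 ++ cs2 -> c \in used par3.
  by move=> cc; rewrite inE p3cs //; apply/eqP/usecs.
have parent3 c x : par3 c = Some x -> c \in cs1 ++ cs2 ->
    [\/ (ohead cs1 == Some c) && (x == v), (ohead cs2 == Some c) && (x == w) |
        exists2 c', c' \in used par3 & own x c'].
  move=> /p3 pc; rewrite mem_cat => /orP[cin|cin].
    have [H|[c' c'in H]] := walk_parent walk1' cin pc; first by constructor 1.
    by constructor 3; exists c' => //; apply: used3; rewrite mem_cat c'in.
  have [H|[c' c'in H]] := walk_parent walk2 cin pc; first by constructor 2.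
  by constructor 3; exists c' => //; apply: used3; rewrite mem_cat c'in orbT.
exists par3, (cs1, cs2); split=> //=.
- split.
  + split; last 2 first.
    * by move=> c x /p3; apply: forest_nbr F2 _ _.
    * move=> c x c' pc xc'; case: (boolP (c \in cs1 ++ cs2)) => cin; last first.
        have := forest_own F (old3 _ _ pc cin) xc'.
        by rewrite !inE; case pc': (par c') => [y|] //; rewrite (p3old _ _ pc').
      case: (parent3 _ _ pc cin) => [/andP[_ /eqP xv]|/andP[_ /eqP xw]|[c'' u3 xc'']].
      - by case: rv => _ /(_ c'); rewrite -xv xc'.
      - by case: rw => _ /(_ c'); rewrite -xw xc'.
      - by rewrite (own_inj xc' xc'').
    apply: extendable_sub (forest_nbr F2) _ (forest_ext F2) => c.
    by rewrite ffunE; case: ifP; [right | left].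
  + by rewrite /linked /= (walk_nbr_walk F1 walk1) (walk_nbr_walk F2 walk2).
  + have -> : used par3 = used par :|: [set c in cs1 ++ cs2].
      apply/setP => c; rewrite in_setU [c \in [set _ in _]]inE orbC.
      case: (boolP (c \in cs1 ++ cs2)) => cin /=; first exact: used3.
      rewrite !inE; case pc: (par c) => [x|]; first by rewrite (p3old _ _ pc).
      by rewrite ffunE (negbTE cin) inE pc.
    rewrite cardsU (_ : _ :&: _ = set0) ?cards0 ?subn0.
      by rewrite [X in _ + X]cardsE (card_uniqP uncs) size_cat sz1 sz2 mul2n addnn.
    apply/setP => c; rewrite !inE; apply/negP => /andP[pc /newcs pc'].
    by rewrite pc' in pc.
- by move=> c cin; split; [apply: newcs | rewrite p3cs //; apply: usecs].
- by move=> c; case pc: (par c) => [x|] // _; rewrite (p3old _ _ pc).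
move=> z rz.
(* A terminal owns no cycle, so it can gain only the first cycle of each kept branch. *)
have sub : kids par3 z \subset kids par z :|:
    (if z == v then [set c | ohead cs1 == Some c] else set0) :|:
    (if z == w then [set c | ohead cs2 == Some c] else set0).
  apply/subsetP => c; rewrite !in_setU ![_ \in kids _ _]inE => /eqP pc.
  case: (boolP (c \in cs1 ++ cs2)) => cin; last by rewrite (old3 _ _ pc cin) eqxx.
  case: (parent3 _ _ pc cin) => [/andP[h ->]|/andP[h ->]|[c' _ zc']].
  - by rewrite inE h orbT.
  - by rewrite inE h orbT.
  - by case: rz => _ /(_ c'); rewrite zc'.
apply: leq_trans (subset_leq_card sub) _.
apply: leq_trans (leq_card_setU _ _) _; apply: leq_add.
  apply: leq_trans (leq_card_setU _ _) _; rewrite leq_add2l.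
  by case: (z == v); rewrite ?cards0 ?card_ohead.
by case: (z == w); rewrite ?cards0 ?card_ohead.
Qed.

(** Invariant: the children already kept by an endpoint plus the links it still has to start number
    at most two. *)
Lemma link_all prs par :
  forest par -> (forall p, p \in prs -> terminal p.1 /\ terminal p.2) ->
  (forall z, terminal z -> #|kids par z| + (count (fun p => p.1 == z) prs +
     count (fun p => p.2 == z) prs) <= 2) ->
  #|used par| + 2 * k * size prs + 4 * 2 ^ k <= M ->
  exists qs, [/\ all2 linked prs qs, uniq (flatten [seq q.1 ++ q.2 | q <- qs]) &
    forall c, c \in flatten [seq q.1 ++ q.2 | q <- qs] -> par c = None].
Proof.
elim: prs par => [|[v w] prs IH] par F rts cnt sizeM; first by exists [::].
have [rv rw] := rts _ (mem_head _ _); rewrite /= in rv rw.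
have cv := cnt v rv; have cw := cnt w rw; rewrite /= !eqxx in cv cw.
have [||| par' [q [[F' lq u'] uq newq old' kids']]] := link_pair F rv rw.
- by move: cv; lia.
- by move: cw; rewrite [w == v]eq_sym; case: (v == w); lia.
- by move: sizeM; clear; lia.
have [||| qs [lqs uqs newqs]] := IH par' F'.
- by move=> p pin; apply: rts; rewrite inE pin orbT.
- move=> z rz; have := cnt z rz; have := kids' z rz => /=.
  by rewrite ![z == _]eq_sym; lia.
- by rewrite u'; move: sizeM => /=; rewrite mulnS; clear; lia.
exists (q :: qs); split=> /=.
- by rewrite lq lqs.
- rewrite cat_uniq uq uqs andbT; apply/hasPn => c /newqs pc'.
  by apply/negP => /newq[].
- move=> c; rewrite mem_cat => /orP[/newq[] //|/newqs pc'].
  by case pc: (par c) => [x|] //; have := old' c; rewrite pc pc' => H; case: H.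
Qed.

Theorem linking prs :
  (forall A : {set T}, A \subset Y -> #|A| <= 2 * m -> 4 * #|A| <= #|cnbr g A|) ->
  (forall p, p \in prs -> terminal p.1 /\ terminal p.2) ->
  (forall z, count (fun p => p.1 == z) prs + count (fun p => p.2 == z) prs <= 2) ->
  2 * k * size prs + 4 * 2 ^ k <= M ->
  exists qs, all2 linked prs qs /\ uniq (flatten [seq q.1 ++ q.2 | q <- qs]).
Proof.
move=> small rts cnt sizeM; pose par : {ffun I -> option T} := [ffun=> None].
have F : forest par.
  split=> [|c v|c v c']; rewrite ?ffunE //.
  apply/extendableP => A sA cA; apply: leq_trans (small A sA cA) _.
  by apply/subset_leq_card/subsetP => c cA'; rewrite inE ffunE.
have used0 : used par = set0 by apply/setP => c; rewrite !inE ffunE.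
have kids0 z : kids par z = set0 by apply/setP => c; rewrite !inE ffunE.
have [||qs [lqs uqs _]] := link_all F rts.
- by move=> z _; rewrite kids0 cards0 add0n; apply: cnt.
- by rewrite used0 cards0.
by exists qs.
Qed.

End Trees.

(** * Splicing sequences *)

Section Sequences.
Variables (T : finType).
Implicit Types (x y a b v w : T) (p q s t : seq T) (H : rel T).

Lemma path_zip x q : path [rel a b | (a, b) \in zip (x :: q) q] x q.
Proof.
elim: q x => //= y q IH x; rewrite inE eqxx /=.
by apply: sub_path (IH y) => a b /= ab; rewrite inE ab orbT.
Qed.

Lemma sorted_pedge p : sorted (pedge p) p.
Proof.
case: p => //= x q; apply: sub_path (path_zip x q) => a b /= ab.
by rewrite /pedge /= ab.
Qed.

Lemma cycle_cedge p : cycle (cedge p) p.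
Proof.
case: p => // x q; rewrite /cycle; apply: sub_path (path_zip x (rcons q x)) => a b /=.
have -> : zip (x :: rcons q x) (rcons q x) = zip (x :: q) (rot 1 (x :: q)).
  rewrite rot1_cons -rcons_cons -[rcons (x :: q) x]cats1 -[in LHS](cats0 (rcons q x)).
  by rewrite zip_cat ?size_rcons //= cats0.
by rewrite /cedge => ->.
Qed.

Lemma zip_behead_split p a b : (a, b) \in zip p (behead p) ->
  exists p1 p2, p = p1 ++ [:: a, b & p2].
Proof.
elim: p => [|x [|y p] IH] //=; rewrite inE => /orP[/eqP[-> ->]|/IH[p1 [p2 ->]]].
  by exists [::], p.
by exists (x :: p1), p2.
Qed.

Lemma zip_behead_cat p x q :
  zip (p ++ x :: q) (behead (p ++ x :: q)) =
    zip (rcons p x) (behead (rcons p x)) ++ zip (x :: q) q.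
Proof.
elim: p => [|y p IH] //=.
by case: p IH => [|z p] //= ->.
Qed.

(** Inserting [t] destroys only the edge [a b], so the other cycles can still be absorbed
    afterwards. *)
Lemma pedge_insert p1 p2 a b t c d :
  pedge (p1 ++ [:: a, b & p2]) c d -> (c, d) != (a, b) -> (d, c) != (a, b) ->
  pedge (p1 ++ a :: t ++ b :: p2) c d.
Proof.
move=> + /negbTE n1 /negbTE n2; rewrite /pedge !zip_behead_cat !mem_cat /= !in_cons n1 n2 /=.
have -> : zip (a :: t ++ b :: p2) (t ++ b :: p2) =
   zip (rcons (a :: t) b) (behead (rcons (a :: t) b)) ++ zip (b :: p2) p2.
  by rewrite -zip_behead_cat.
by rewrite !mem_cat; do !case: (_ \in _).
Qed.

Lemma sorted_insert H p1 p2 a b t : path H a (rcons t b) ->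
  sorted H (p1 ++ [:: a, b & p2]) -> sorted H (p1 ++ a :: t ++ b :: p2).
Proof.
rewrite rcons_path => /andP[pt tb].
have Q x p q : path H x (p ++ a :: q) = path H x (rcons p a) && path H a q.
  by rewrite cat_path rcons_path /= andbA.
case: p1 => [|x p1]; rewrite /= ?Q /= !cat_path /= pt tb /=; first by case/andP.
by case/and3P => -> _ ->.
Qed.

(** * Absorbing cycles into a path *)

Section Absorb.
Variables (I : eqType) (H : rel T) (aa bb : I -> T) (sg : I -> seq T) (x0 : T).
Hypothesis symH : symmetric H.
Hypothesis sgH : forall c, path H (bb c) (rcons (sg c) (aa c)).

Lemma path_rev_rcons a b t : path H b (rcons t a) -> path H a (rcons (rev t) b).
Proof.
have := rev_path H b (rcons t a); rewrite last_rcons belast_rcons rev_cons.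
by move=> -> ; rewrite (eq_path (e' := H)) // => u v; apply: symH.
Qed.

(** Induction on [cs]: the edge of one cycle is replaced by its detour. The attaching edges being
    disjoint, those of the remaining cycles survive. *)
Lemma absorb_cycles (cs : seq I) p :
  uniq cs -> sorted H p -> (forall c, c \in cs -> pedge p (aa c) (bb c)) ->
  (forall c c', c \in cs -> c' \in cs -> c != c' -> aa c != aa c' /\ aa c != bb c') ->
  exists q, [/\ sorted H q, head x0 q = head x0 p, last x0 q = last x0 p &
                perm_eq q (p ++ flatten (map sg cs))].
Proof.
elim: cs p => [|c cs IH] p /=; first by exists p; rewrite cats0.
case/andP=> cnot uncs sp pe dist.
have [p' [sp' hp' lp' pp' pe']] : exists p', [/\ sorted H p', head x0 p' = head x0 p,
    last x0 p' = last x0 p, perm_eq p' (p ++ sg c) &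
    forall c', c' \in cs -> pedge p' (aa c') (bb c')].
  (* The path may traverse the attaching edge in either direction; [t] is the detour or its reverse
     accordingly. *)
  have ins a b t : perm_eq t (sg c) -> path H a (rcons t b) ->
      (a, b) \in [:: (aa c, bb c); (bb c, aa c)] -> (a, b) \in zip p (behead p) ->
      exists p', [/\ sorted H p', head x0 p' = head x0 p,
        last x0 p' = last x0 p, perm_eq p' (p ++ sg c) &
        forall c', c' \in cs -> pedge p' (aa c') (bb c')].
    move=> pt Ht ab /zip_behead_split[p1 [p2 ep]]; subst p.
    exists (p1 ++ a :: t ++ b :: p2); split.
    - exact: sorted_insert.
    - by case: (p1).
    - by rewrite !last_cat /= last_cat.
    - rewrite -catA perm_cat2l /= perm_cons perm_sym -cat_cons perm_catC.
      by rewrite perm_cat // perm_sym.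
    - move=> c' c'in; apply: pedge_insert; first by apply: pe; rewrite inE c'in orbT.
        have [] := dist c' c; rewrite ?inE ?c'in ?eqxx ?orbT //.
          by apply: contraNneq cnot => <-.
        move=> /negbTE n1 /negbTE n2; move: ab; rewrite !inE.
        by case/orP => /eqP[-> ->]; rewrite xpair_eqE ?n1 ?n2.
      have [] := dist c' c; rewrite ?inE ?c'in ?eqxx ?orbT //.
        by apply: contraNneq cnot => <-.
      move=> /negbTE n1 /negbTE n2; move: ab; rewrite !inE.
      by case/orP => /eqP[-> ->]; rewrite xpair_eqE ?n1 ?n2 andbF.
  have := pe c (mem_head _ _); rewrite /pedge => /orP[ab|ba].
    apply: (ins (aa c) (bb c) (rev (sg c))) => //; first by rewrite perm_rev.
      exact: path_rev_rcons.
    by rewrite inE eqxx.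
  by apply: (ins (bb c) (aa c) (sg c)); rewrite // !inE eqxx orbT.
have [c1 c2 c1in c2in|q [sq hq lq pq]] := IH p' uncs sp' pe'.
  by apply: dist; rewrite inE ?c1in ?c2in orbT.
exists q; split; rewrite ?hq ?lq //.
by apply: perm_trans pq _; rewrite catA perm_cat2r.
Qed.
End Absorb.

(** * Joining paths cyclically by links *)

Section Glue.
Variables (H : rel T) (x0 : T).

(** The last path is joined to [w]; taking for [w] the head of the first path closes the cycle. *)
Fixpoint junctions (ps : seq (seq T)) w : seq (T * T) :=
  if ps is p :: ps' then (last x0 p, head w (map (head x0) ps')) :: junctions ps' w
  else [::].

Fixpoint glue (ps ls : seq (seq T)) : seq T :=
  match ps, ls with
  | p :: ps', l :: ls' => p ++ l ++ glue ps' ls'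
  | _, _ => [::]
  end.

(** Appending [w] matches the definition of [cycle], which is a path returning to its first
    vertex. *)
Lemma sorted_glue ps ls w :
  all (fun p => p != [::]) ps -> all (sorted H) ps ->
  all2 (fun j l => path H j.1 (rcons l j.2)) (junctions ps w) ls ->
  exists s, rcons (glue ps ls) w = head w (map (head x0) ps) :: s /\
            path H (head w (map (head x0) ps)) s.
Proof.
elim: ps ls => [|[|x p] ps IH] [|l ls] //=; first by exists [::].
move=> /IH{}IH /andP[px /IH{}IH] /andP[pl /IH[s [es ps']]].
exists (p ++ l ++ rcons (glue ps ls) w); split; first by rewrite !rcons_cat.
rewrite es !cat_path px /= ps' andbT.
by move: pl; rewrite rcons_path.
Qed.

Lemma perm_glue ps ls : size ps = size ls ->
  perm_eq (glue ps ls) (flatten ps ++ flatten ls).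
Proof.
elim: ps ls => [|p ps IH] [|l ls] //= [/IH pe].
rewrite -catA perm_cat2l perm_sym perm_catCA perm_cat2l perm_sym.
exact: pe.
Qed.

Lemma size_junctions ps w : size (junctions ps w) = size ps.
Proof. by elim: ps => //= p ps ->. Qed.

Lemma junctions_fst ps w : map fst (junctions ps w) = map (last x0) ps.
Proof. by elim: ps => //= p ps ->. Qed.

Lemma junctions_snd p ps w :
  map snd (junctions (p :: ps) w) = rcons (map (head x0) ps) w.
Proof. by elim: ps p => //= q ps IH p; rewrite -(IH q). Qed.

End Glue.
End Sequences.

(** * Assembling the Hamilton cycle *)

Lemma perm_flatten_cat (S T : eqType) (f h : S -> seq T) (s : seq S) :
  perm_eq (flatten [seq f c ++ h c | c <- s]) (flatten (map f s) ++ flatten (map h s)).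
Proof.
elim: s => //= c s IH; rewrite -!catA perm_cat2l perm_sym perm_catCA perm_cat2l.
by rewrite perm_sym.
Qed.

Lemma perm_flatten_map (S T : eqType) (f h : S -> seq T) (s : seq S) :
  (forall c, perm_eq (f c) (h c)) ->
  perm_eq (flatten (map f s)) (flatten (map h s)).
Proof. by move=> fh; elim: s => //= c s IH; apply: perm_cat. Qed.

Lemma uniq_flatten_inj (S T : eqType) (f : S -> seq T) (s : seq S) c c' v :
  uniq (flatten (map f s)) -> c \in s -> c' \in s -> v \in f c -> v \in f c' -> c = c'.
Proof.
elim: s => //= x s IH; rewrite cat_uniq => /and3P[_ /hasPn dis /IH{}IH].
have no y : y \in s -> v \in f y -> v \in f x -> false.
  move=> ys vy vx; have := dis v; rewrite vx => H.
  by have /H : v \in flatten (map f s) by apply/flatten_mapP; exists y.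
rewrite !inE => /orP[/eqP->|cs] /orP[/eqP->|c's] //; last exact: IH.
  by move=> vx /no/(_ vx) => /(_ c's).
by move=> /no/(_ _) vc vx; have := vc cs vx.
Qed.

Section Assembly.
Variables (T : finType) (e : rel T) (P1 : seq T) (Ps Cs : seq (seq T)) (x0 : T).
Local Notation I := 'I_(size Cs).
Variables (aa bb zz : I -> T) (ss : I -> seq T).
Let H := unionG e (P1 :: Ps) Cs.

Hypothesis e_sym : symmetric e.
Hypothesis paths_nonempty : all (fun p => p != [::]) (P1 :: Ps).
Hypothesis paths_uniq : uniq (flatten (P1 :: Ps)).
Hypothesis cycles_uniq : uniq (flatten Cs).
Hypothesis cycles_paths : forall v, v \in flatten Cs -> v \notin flatten Ps.
Hypothesis covered : forall v, (v \in flatten (P1 :: Ps)) || (v \in flatten Cs).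
Hypothesis rotC : forall c : I, exists i, rot i (nth [::] Cs c) = [:: aa c, bb c, zz c & ss c].
Hypothesis P1_edge : forall c, pedge P1 (aa c) (bb c).
Hypothesis P1_meets : forall (c : I) v,
  v \in nth [::] Cs c -> v \in P1 -> v = aa c \/ v = bb c.

(** The part of the cycle that avoids [P1]. Its two ends are the flexible vertices, which coincide
    for a triangle. *)
Definition detour (c : I) : seq T := zz c :: ss c.
Definition exit_end (c : I) : T := last (zz c) (ss c).
Definition cycle_nbr v (c : I) : bool := e v (exit_end c) || e v (zz c).
Definition far_end v (c : I) : T := if e v (zz c) then exit_end c else zz c.
Definition flexible v (c : I) : bool := (v == exit_end c) || (v == zz c).

Lemma perm_cycle (c : I) : perm_eq (nth [::] Cs c) ([:: aa c; bb c] ++ detour c).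
Proof. by have [i ri] := rotC c; rewrite -(perm_rot i) ri. Qed.

Lemma flatten_cycles : flatten Cs = flatten [seq nth [::] Cs c | c : I <- enum I].
Proof.
congr flatten; rewrite (map_comp (nth [::] Cs) val) val_enum_ord.
by rewrite map_nth_iota0 // take_size.
Qed.

Lemma perm_cycles : perm_eq (flatten Cs)
  (flatten [seq [:: aa c; bb c] | c <- enum I] ++ flatten (map detour (enum I))).
Proof.
rewrite flatten_cycles; apply: perm_trans (perm_flatten_cat _ _ _).
exact/perm_flatten_map/perm_cycle.
Qed.

Lemma detours_uniq : uniq (flatten (map detour (enum I))).
Proof. by move: cycles_uniq; rewrite (perm_uniq perm_cycles) cat_uniq => /and3P[]. Qed.

Lemma detour_inj c c' v : v \in detour c -> v \in detour c' -> c = c'.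
Proof. exact: uniq_flatten_inj detours_uniq (mem_enum _ _) (mem_enum _ _). Qed.

Lemma attach_inj c c' v :
  v \in [:: aa c; bb c] -> v \in [:: aa c'; bb c'] -> c = c'.
Proof.
apply: (@uniq_flatten_inj _ _ (fun c => [:: aa c; bb c]) (enum I)); rewrite ?mem_enum //.
by move: cycles_uniq; rewrite (perm_uniq perm_cycles) cat_uniq => /and3P[].
Qed.

Lemma mem_cycles (c : I) v : v \in nth [::] Cs c -> v \in flatten Cs.
Proof. by move=> vc; apply/flattenP; exists (nth [::] Cs c) => //; apply: mem_nth. Qed.

Lemma detour_notin_paths c v : v \in detour c -> v \notin flatten (P1 :: Ps).
Proof.
move=> vd; have vc : v \in nth [::] Cs c by rewrite (perm_mem (perm_cycle c)) mem_cat vd orbT.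
rewrite /= mem_cat negb_or cycles_paths ?(mem_cycles vc) // andbT.
apply/negP => /(P1_meets vc) vab.
move: cycles_uniq; rewrite (perm_uniq perm_cycles) cat_uniq => /and3P[_ /hasPn dis _].
have /dis/negP[] : v \in flatten (map detour (enum I)).
  by apply/flatten_mapP; exists c; rewrite ?mem_enum.
apply/flatten_mapP; exists c; rewrite ?mem_enum //.
by case: vab => ->; rewrite !inE eqxx ?orbT.
Qed.

Lemma flexible_detour v c : flexible v c -> v \in detour c.
Proof. by case/orP => /eqP->; rewrite ?mem_last // mem_head. Qed.

Lemma H_sym : symmetric H.
Proof.
move=> a b; rewrite /H /unionG e_sym; congr [|| _, _ | _].
  by apply: eq_has => p; rewrite /pedge orbC.
by apply: eq_has => c; rewrite /cedge orbC.
Qed.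

Lemma H_path p : p \in P1 :: Ps -> sorted H p.
Proof.
move=> pin; apply: sub_sorted (sorted_pedge p) => a b ab.
by rewrite /H /unionG (introT hasP) ?orbT //; exists p.
Qed.

Lemma H_cycle c : [/\ path H (zz c) (ss c), H (bb c) (zz c) & H (exit_end c) (aa c)].
Proof.
have : cycle H (nth [::] Cs c).
  have cin : nth [::] Cs c \in Cs by apply: mem_nth.
  have := cycle_cedge (nth [::] Cs c); apply: sub_cycle => a b ab.
  rewrite /H /unionG (introT (hasP (a := fun p => cedge p a b))) ?orbT //.
  by exists (nth [::] Cs c).
have [i ri] := rotC c; rewrite -(rot_cycle i) ri /= rcons_path => /and4P[_ -> -> ->].
by [].
Qed.

Lemma H_detour c : path H (bb c) (rcons (detour c) (aa c)).
Proof. by have [p1 h1 h2] := H_cycle c; rewrite rcons_path /= h1 p1 h2. Qed.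

(** Follows the convention of [far_end]: a cycle both of whose flexible vertices are adjacent to [v]
    is entered at [zz c]. *)
Definition oriented v c := if e v (zz c) then detour c else rev (detour c).

Fixpoint trail v (cs : seq I) : seq T :=
  if cs is c :: cs' then oriented v c ++ trail (far_end v c) cs' else [::].

Lemma perm_trail v cs : perm_eq (trail v cs) (flatten (map detour cs)).
Proof.
elim: cs v => // c cs IH v; apply: (@perm_cat _ (oriented v c) (detour c)) (IH _).
by rewrite /oriented; case: ifP => // _; rewrite perm_rev.
Qed.

Lemma path_trail v cs : nbr_walk cycle_nbr far_end v cs ->
  path H v (trail v cs) /\ last v (trail v cs) = foldl far_end v cs.
Proof.
elim: cs v => //= c cs IH v /andP[gv /IH[pt <-]].
have [pH _ _] := H_cycle c.
suff [po lo] : path H v (oriented v c) /\ last v (oriented v c) = far_end v c.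
  by rewrite cat_path last_cat lo po pt.
rewrite /oriented /far_end; case: ifPn gv => [ev _|/negbTE ev].
  by rewrite /= pH /H /unionG ev.
rewrite /cycle_nbr ev orbF => ev'.
split; last by rewrite rev_cons last_rcons.
have -> : rev (detour c) = exit_end c :: rev (belast (zz c) (ss c)).
  by rewrite /detour lastI rev_rcons.
rewrite /= rev_path (eq_path (e' := H)) ?pH ?andbT.
  by rewrite /H /unionG ev'.
by move=> a b; apply: H_sym.
Qed.

(** The second tree grows from the start of the next path, so its trail is traversed backwards. *)
Definition link (j : T * T) (q : seq I * seq I) := trail j.1 q.1 ++ rev (trail j.2 q.2).

Lemma perm_link j q : perm_eq (link j q) (flatten (map detour (q.1 ++ q.2))).
Proof.
rewrite map_cat flatten_cat; apply: perm_cat; first exact: perm_trail.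
by rewrite perm_rev; apply: perm_trail.
Qed.

Lemma path_link j q : linked cycle_nbr far_end e j q -> path H j.1 (rcons (link j q) j.2).
Proof.
case/and3P => /path_trail[p1 l1] /path_trail[p2 l2] ee.
rewrite rcons_cat cat_path p1 /= -rev_cons lastI rev_rcons /= l1 l2.
rewrite /H /unionG ee /= -/H -l2 rev_path (eq_path (e' := H)) //.
by move=> a b; apply: H_sym.
Qed.

Lemma perm_links js qs : size qs = size js ->
  perm_eq (flatten [seq link jq.1 jq.2 | jq <- zip js qs])
          (flatten (map detour (flatten [seq q.1 ++ q.2 | q <- qs]))).
Proof.
elim: qs js => [|q qs IH] [|j js] //= [/IH pe].
by rewrite map_cat flatten_cat; apply: perm_cat pe; apply: perm_link.
Qed.

Lemma path_links js qs : all2 (linked cycle_nbr far_end e) js qs ->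
  all2 (fun j l => path H j.1 (rcons l j.2)) js [seq link jq.1 jq.2 | jq <- zip js qs].
Proof. by elim: js qs => [|j js IH] [|q qs] //= /andP[/path_link-> /IH]. Qed.

Lemma hamiltonian_assemble (qs : seq (seq I * seq I)) :
  2 < #|T| ->
  all2 (linked cycle_nbr far_end e) (junctions x0 (P1 :: Ps) (head x0 P1)) qs ->
  uniq (flatten [seq q.1 ++ q.2 | q <- qs]) ->
  hamiltonian H.
Proof.
move=> T2; set w := head x0 P1; set js := junctions _ _ _; set U := flatten _ => lqs uqs.
(* The cycles in no link are absorbed into [P1]; the resulting path [P] has the same ends, so the
   junctions are unchanged. *)
pose cs0 := [seq c <- enum I | c \notin U].
have ucs0 : uniq cs0 by rewrite filter_uniq ?enum_uniq.
have [|c c' _ _ cc'|P [sP hP lP pP]] :=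
  absorb_cycles x0 H_sym H_detour ucs0 (H_path (mem_head _ _)).
- by move=> c _; apply: P1_edge.
- by split; apply: contraNneq cc' => ac; apply/eqP/(@attach_inj _ _ (aa c));
    rewrite ?ac !inE eqxx ?orbT.
pose ls := [seq link jq.1 jq.2 | jq <- zip js qs].
have szqs : size qs = size js by move: lqs; rewrite all2E => /andP[/eqP].
have jsE : junctions x0 (P :: Ps) w = js by rewrite /js /= lP.
have Pne : P != [::].
  have /andP[P1ne _] := paths_nonempty.
  by rewrite -size_eq0 (perm_size pP) size_cat addn_eq0 negb_and size_eq0 P1ne.
have [|||s [es ps]] := @sorted_glue _ H x0 (P :: Ps) ls w.
- by rewrite /= Pne; case/andP: paths_nonempty.
- by rewrite /= sP; apply/allP => p pin; apply: H_path; rewrite inE pin orbT.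
- by rewrite jsE; apply: path_links.
move: es ps; rewrite [map _ _]/= [head w _]/= hP -/w.
set big := glue _ _ => es ps.
(* Every detour occurs exactly once, either in a link or inside [P]; the vertices [aa c] and [bb c]
   are already on [P1]. *)
have pbig : perm_eq big (flatten (P1 :: Ps) ++ flatten (map detour (enum I))).
  apply: perm_trans (perm_glue _) _; first by rewrite size_map size_zip szqs minnn size_junctions.
  have pU : perm_eq (enum I) (cs0 ++ U).
    apply: uniq_perm; first exact: enum_uniq.
      rewrite cat_uniq ucs0 uqs andbT; apply/hasPn => c cU.
      by rewrite mem_filter cU.
    by move=> c; rewrite mem_enum mem_cat mem_filter mem_enum andbT orNb.
  have pe := perm_flatten (perm_map detour pU); rewrite map_cat flatten_cat in pe.
  have pl := perm_links szqs.
  rewrite perm_sym (permPl (perm_cat (perm_refl _) pe)) /=.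
  rewrite perm_sym (permPl (perm_cat (perm_cat pP (perm_refl _)) pl)).
  by rewrite -!catA perm_cat2l perm_catCA.
have ubig : uniq big.
  rewrite (perm_uniq pbig) cat_uniq paths_uniq detours_uniq andbT.
  by apply/hasPn => v /flatten_mapP[c _ /detour_notin_paths].
have fbig v : v \in big.
  rewrite (perm_mem pbig) mem_cat.
  have /orP[-> //|] := covered v; rewrite (perm_mem perm_cycles) mem_cat.
  case/orP => [/flatten_mapP[c _]|->]; last by rewrite orbT.
  rewrite !inE => vab; apply/orP; left; rewrite /= mem_cat; apply/orP; left.
  have := P1_edge c; rewrite /pedge => /orP[] /zip_behead_split[p1 [p2 ->]];
    by case/orP: vab => /eqP->; rewrite mem_cat !inE eqxx ?orbT.
have szbig : size big = #|T|.
  by rewrite -(card_uniqP ubig); apply: eq_card => v; rewrite fbig.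
exists big; split=> //; first by rewrite szbig.
case: big es {pbig ubig fbig szbig} => [|x b] //= [-> <-] in ps *.
exact: ps.
Qed.

End Assembly.

Local Open Scope ring_scope.

(** * Expander mixing *)

Lemma char_poly_conj (F : fieldType) n (P D : 'M[F]_n) :
  P \in unitmx -> char_poly (invmx P *m D *m P) = char_poly D.
Proof.
move=> uP; rewrite /char_poly /char_poly_mx !map_mxM /=.
set Q := map_mx polyC P; set Q' := map_mx polyC (invmx P).
have QQ : Q' *m Q = 1%:M by rewrite -map_mxM mulVmx // map_mx1.
have -> : 'X%:M - Q' *m map_mx polyC D *m Q = Q' *m ('X%:M - map_mx polyC D) *m Q.
  by rewrite mulmxBr mulmxBl scalar_mxC -[_ *m Q' *m Q]mulmxA QQ mulmx1.
by rewrite !det_mulmx mulrAC -det_mulmx QQ det1 mul1r.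
Qed.

Local Open Scope sesquilinear_scope.

Section MixingC.
Variables (C : numClosedFieldType) (n : nat).
Local Notation "''[' u , v ]" := (dotmx u v) : ring_scope.
Local Notation "''[' u ]" := '[u, u] : ring_scope.

Lemma dotmx_sum (x y : 'rV[C]_n) : '[x, y] = \sum_i x 0 i * (y 0 i)^*.
Proof. by rewrite dotmxE mxE; apply: eq_bigr => i _; rewrite !mxE. Qed.

Lemma dotmx_unitary (P : 'M[C]_n) (x y : 'rV[C]_n) :
  P \is unitarymx -> '[x *m P^t*, y *m P^t*] = '[x, y].
Proof.
by move=> uP; rewrite !dotmxE trmx_mul map_mxM trmxCK mulmxA mulmxKtV.
Qed.

Lemma dotmx_spectral (A : 'M[C]_n) (x y : 'rV[C]_n)
    (P := spectralmx A) (sp := spectral_diag A) :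
  A \is normalmx ->
  '[x *m A, y] = \sum_i sp 0 i * ((x *m P^t*) 0 i * ((y *m P^t*) 0 i)^*).
Proof.
move=> /orthomx_spectralP nA; have uP : P \is unitarymx by apply: spectral_unitarymx.
rewrite {1}nA -/P -/sp -(dotmx_unitary _ _ uP) invmx_unitary //.
rewrite !mulmxA (mulmxtVK _ uP) dotmx_sum; apply: eq_bigr => i _.
by rewrite mul_mx_diag mxE mulrA; congr (_ * _); rewrite mulrC.
Qed.

(** In a spectral basis the all-ones vector carries the whole eigenspace of [d]. Its coordinate
    yields the main term, and Cauchy-Schwarz bounds the rest by [lam]. *)
Lemma expander_mixing_dot (A : 'M[C]_n) (d lam : C) (s : seq C) (x y : 'rV[C]_n)
    (u : 'rV[C]_n := const_mx 1) :
  A \is normalmx -> (0 < n)%N -> 0 <= lam -> lam < d ->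
  char_poly A = \prod_(z <- d :: s) ('X - z%:P) ->
  (forall z, z \in s -> `|z| <= lam) -> u *m A = d *: u ->
  `| '[x *m A, y] - d / n%:R * ('[x, u] * '[u, y]) | ^+ 2
     <= lam ^+ 2 * ('[x] * '[y]).
Proof.
move=> nA n0 lam0 lamd chA sle uA.
set P := spectralmx A; set sp := spectral_diag A.
have uP : P \is unitarymx by apply: spectral_unitarymx.
have AE : A = invmx P *m diag_mx sp *m P by apply/orthomx_spectralP.
have pe : perm_eq [seq sp 0 i | i <- enum 'I_n] (d :: s).
  apply: prod_XsubC_eq; rewrite -chA big_map big_enum /=.
  rewrite AE char_poly_conj ?spectral_unit //.
  rewrite char_poly_trig ?diag_mx_is_trig //.
  by apply: eq_bigr => i _; rewrite mxE eqxx mulr1n.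
(* As [lam < d], the eigenvalue [d] is simple and sits at a single index [i0]. *)
have dns : d \notin s.
  apply/negP => /sle; rewrite ger0_norm ?(le_trans lam0 (ltW lamd)) //.
  by move=> /(lt_le_trans lamd); rewrite ltxx.
have [i0 si0] : exists i0, sp 0 i0 = d.
  have : d \in [seq sp 0 i | i <- enum 'I_n] by rewrite (perm_mem pe) mem_head.
  by case/mapP => i _ ->; exists i.
have spn i : i != i0 -> sp 0 i != d.
  move=> ne; apply/eqP => si.
  have sz1 : count [pred j | sp 0 j == d] (enum 'I_n) = 1%N.
    have := permP pe (pred1 d); rewrite /= eqxx (count_memPn dns) addn0 count_map.
    exact.
  have : (size [:: i; i0] <= size (filter [pred j | sp 0%R j == d] (enum 'I_n)))%N.
    apply: uniq_leq_size; first by rewrite /= inE ne.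
    by move=> j; rewrite !inE mem_filter mem_enum andbT => /orP[]/eqP-> /=; rewrite ?si ?si0.
  by rewrite size_filter sz1.
have sple i : i != i0 -> `|sp 0 i| <= lam.
  move=> ne; apply: sle.
  have : sp 0 i \in d :: s by rewrite -(perm_mem pe) map_f // mem_enum.
  by rewrite inE (negbTE (spn _ ne)).
set w := u *m P^t*; set xh := x *m P^t*; set yh := y *m P^t*.
have wi i : i != i0 -> w 0 i = 0.
  move=> ne; have : w *m diag_mx sp = d *: w.
    rewrite /w scalemxAl -uA AE.
    by rewrite invmx_unitary // !mulmxA mulmxtVK.
  move/matrixP => /(_ 0 i); rewrite mul_mx_diag !mxE => /eqP.
  rewrite mulrC -subr_eq0 -mulrBl mulf_eq0 subr_eq0 (negbTE (spn _ ne)) /=.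
  by move/eqP.
have n0' : n%:R != 0 :> C by rewrite pnatr_eq0 -lt0n.
have ww : w 0 i0 * (w 0 i0)^* = n%:R.
  have := dotmx_unitary u u uP; rewrite !dotmx_sum -/w (bigD1 i0) //= big1 ?addr0.
    move=> ->; rewrite (eq_bigr (fun=> 1)) ?sumr_const ?card_ord //.
    by move=> i _; rewrite !mxE conjC1 mulr1.
  by move=> i ne; rewrite wi // mul0r.
have xu : '[x, u] = xh 0 i0 * (w 0 i0)^*.
  rewrite -(dotmx_unitary _ _ uP) -/w dotmx_sum (bigD1 i0) //= big1 ?addr0 //.
  by move=> i ne; rewrite wi // conjC0 mulr0.
have uy : '[u, y] = w 0 i0 * (yh 0 i0)^*.
  rewrite -(dotmx_unitary _ _ uP) -/w dotmx_sum (bigD1 i0) //= big1 ?addr0 //.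
  by move=> i ne; rewrite wi // mul0r.
(* Coordinate [i0] is dropped: since [w 0 i0] has squared modulus [n], it contributes exactly the
   subtracted product. *)
pose z : 'rV[C]_n := \row_i (if i == i0 then 0 else sp 0 i * xh 0 i).
have -> : '[x *m A, y] - d / n%:R * ('[x, u] * '[u, y]) = '[z, yh].
  rewrite dotmx_spectral // xu uy dotmx_sum (bigD1 i0) //= [RHS](bigD1 i0) //=.
  rewrite -/P -/sp -/xh -/yh [z 0 i0]mxE eqxx mul0r add0r si0.
  rewrite [X in d / n%:R * X](_ : _ = n%:R * (xh 0 i0 * (yh 0 i0)^*)); last first.
    by rewrite -ww; ring.
  rewrite mulrA divfK // addrAC subrr add0r.
  by apply: eq_bigr => i ne; rewrite [z 0 i]mxE (negbTE ne) mulrA.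
rewrite -(dotmx_unitary y y uP) -/yh.
have CS : `|'[z, yh]| ^+ 2 <= '[z] * '[yh] := leif_le (CauchySchwarz _ z yh).
apply: le_trans CS _.
rewrite mulrA ler_wpM2r ?dnorm_ge0 //.
rewrite -(dotmx_unitary x x uP) -/xh !dotmx_sum mulr_sumr; apply: ler_sum => i _.
rewrite [z 0 i]mxE; case: eqVneq => [->|ne].
  by rewrite mul0r mulr_ge0 ?exprn_ge0 ?mul_conjC_ge0.
rewrite -!normCK normrM exprMn ler_wpM2r ?exprn_ge0 //.
by rewrite lerXn2r ?nnegrE // sple.
Qed.
End MixingC.

Section Mixing.
Variables (R : realType) (T : finType).

Definition edges_between (e : rel T) (A B : {set T}) : nat :=
  \sum_(u in A) #|[set v in B | e u v]|.

Lemma sum_enum_val (V : nmodType) (F : T -> V) :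
  \sum_(i < #|T|) F (enum_val i) = \sum_x F x.
Proof. by rewrite -(big_enum_val (A := T) F); apply: eq_bigl. Qed.

Lemma edges_betweenE (V : pzRingType) (e : rel T) (A B : {set T}) :
  (edges_between e A B)%:R =
    \sum_v \sum_u (u \in A)%:R * (e u v)%:R * (v \in B)%:R :> V.
Proof.
rewrite exchange_big natr_sum big_mkcond; apply: eq_bigr => u _.
case: (u \in A); last by rewrite big1 // => v _; rewrite !mul0r.
rewrite -sum1_card natr_sum big_mkcond; apply: eq_bigr => v _.
by rewrite inE mul1r; case: (e u v); case: (v \in B); rewrite /= ?mulr1 ?mulr0.
Qed.

Theorem expander_mixing (e : rel T) d (lam : R) (A B : {set T}) :
  ndl_graph e d lam -> lam < d%:R -> (1 < #|T|)%N ->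
  ((edges_between e A B)%:R - d%:R / #|T|%:R * (#|A|%:R * #|B|%:R)) ^+ 2
    <= lam ^+ 2 * (#|A|%:R * #|B|%:R).
Proof.
case=> esym _ ereg [s [s_sort chA sle]] lamd n1.
set M := adjmx R e in chA.
have sz : size s = #|T|.
  by have := size_char_poly M; rewrite chA size_prod_XsubC => -[].
have lam0 : 0 <= lam by apply: le_trans (sle 1%N _); rewrite ?normr_ge0 ?sz.
have M1 : const_mx 1 *m M = d%:R *: const_mx 1 :> 'rV[R]_#|T|.
  apply/matrixP => i j; rewrite !mxE mulr1 -(ereg (enum_val j)).
  rewrite -sum1_card natr_sum [RHS]big_mkcond -sum_enum_val; apply: eq_bigr => k _.
  by rewrite !mxE mul1r inE esym; case: (e _ _).
case: s s_sort chA sle sz => [|s0 s] s_sort chA sle sz.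
  by move: n1; rewrite -sz.
have sle' z : z \in s -> `|z| <= lam.
  by move=> /(nthP 0) [i lti <-]; apply: (sle i.+1).
(* Regularity makes [d] an eigenvalue, and all entries after the first are at most [lam < d]. *)
have s0d : s0 = d%:R.
  have : root (char_poly M) d%:R.
    rewrite -eigenvalue_root_char; apply/eigenvalueP.
    exists (const_mx 1) => //; apply/negP => /eqP/matrixP.
    have n0 : (0 < #|T|)%N by apply: ltnW.
    by move/(_ 0 (Ordinal n0)) => /eqP; rewrite !mxE oner_eq0.
  rewrite chA root_prod_XsubC inE => /orP[/eqP //|/sle'].
  by rewrite normr_nat => /le_lt_trans - /(_ _ lamd); rewrite ltxx.
(* The spectral theorem is applied over [R[i]], where the real symmetric adjacency matrix is
   normal. *)
pose f := real_complex R; pose MC := map_mx f M.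
pose ind (S : {set T}) : 'rV[R[i]]_#|T| := \row_i (enum_val i \in S)%:R.
have nMC : MC \is normalmx.
  apply: symmetric_normalmx.
    apply/is_hermitianmxP; rewrite expr0 scale1r map_mx_id //.
    by apply/matrixP => i j; rewrite !mxE esym.
  apply/mxOverP => i j; rewrite !mxE.
  by case: (e _ _); rewrite /f ?rmorph1 ?rmorph0 ?rpred1 ?rpred0.
have ind1 : const_mx 1 = ind setT by apply/matrixP => i j; rewrite !mxE inE.
have dot_ind S S' : dotmx (ind S) (ind S') = #|S :&: S'|%:R.
  rewrite dotmx_sum -sum1_card natr_sum [RHS]big_mkcond -sum_enum_val.
  apply: eq_bigr => i _; rewrite !mxE conjC_nat inE.
  by case: (_ \in S); case: (_ \in S'); rewrite /= ?mulr1 ?mulr0 ?mul0r.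
have dotM : dotmx (ind A *m MC) (ind B) = (edges_between e A B)%:R.
  rewrite dotmx_sum edges_betweenE -sum_enum_val; apply: eq_bigr => i _.
  rewrite !mxE conjC_nat -sum_enum_val mulr_suml; apply: eq_bigr => j _.
  by rewrite !mxE /f rmorph_nat.
have := @expander_mixing_dot _ _ MC (f d%:R) (f lam) (map f s) (ind A) (ind B) nMC.
rewrite ind1 !dot_ind dotM setTI setIT !setIid.
have f_real z : f z \is Num.real.
  by rewrite realE -(rmorph0 (real_complex R)) !lecR; apply: le_total.
have f_norm z : `|f z| ^+ 2 = f (z ^+ 2) by rewrite real_normK // /f -(rmorphXn (real_complex R)).
have -> : (edges_between e A B)%:R - f d%:R / #|T|%:R * (#|A|%:R * #|B|%:R)
    = f ((edges_between e A B)%:R - d%:R / #|T|%:R * (#|A|%:R * #|B|%:R)).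
  by rewrite /f (rmorphB (real_complex R)) !(rmorphM (real_complex R)) fmorphV /= !rmorph_nat.
have -> : f lam ^+ 2 * (#|A|%:R * #|B|%:R) = f (lam ^+ 2 * (#|A|%:R * #|B|%:R)).
  rewrite /f (rmorphM (real_complex R)) (rmorphXn (real_complex R)).
  by rewrite (rmorphM (real_complex R)) /= !rmorph_nat.
rewrite f_norm => H; rewrite -lecR; apply: H.
- exact: ltnW.
- by rewrite ler0c.
- by rewrite ltcR.
- rewrite -map_char_poly chA s0d map_prod_XsubC -map_cons big_map.
  by apply: eq_bigr.
- move=> _ /mapP[z zs ->].
  rewrite -(@ler_pXn2r _ 2) ?nnegrE ?normr_ge0 ?ler0c //.
  rewrite f_norm /f -(rmorphXn (real_complex R)) lecR -(real_normK (num_real z)).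
  by rewrite ler_pXn2r ?nnegrE ?normr_ge0 ?sle'.
- rewrite -ind1.
  have -> : const_mx 1 = map_mx f (const_mx 1) :> 'rV_#|T|.
    by rewrite map_const_mx /f rmorph1.
  by rewrite -map_mxM M1 map_mxZ.
Qed.
End Mixing.

(** * Expansion in (n, d, lambda)-graphs *)

Section Expansion.
Variables (R : realType) (T : finType) (e : rel T) (d : nat) (lam : R).
Hypothesis ndl : ndl_graph e d lam.
Hypothesis T_gt1 : (1 < #|T|)%N.
Implicit Types A B N : {set T}.
Hypothesis lam_d : lam < d%:R / 500.

Lemma ndl_lam_ge0 : 0 <= lam.
Proof.
case: ndl => _ _ _ [s [_ chA sle]].
have sz : size s = #|T|.
  by have := size_char_poly (adjmx R e); rewrite chA size_prod_XsubC => -[].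
by apply: le_trans (sle 1%N _); rewrite ?normr_ge0 ?sz.
Qed.

Let lam0 := ndl_lam_ge0.
Local Notation n := (#|T|%:R : R).

Let n_gt0 : 0 < n. Proof. by rewrite ltr0n ltnW. Qed.
Let d_gt0 : 0 < d%:R :> R. Proof. have := lam0; have := lam_d; lra. Qed.

Lemma mixing A B :
  ((edges_between e A B)%:R - d%:R / n * (#|A|%:R * #|B|%:R)) ^+ 2
    <= lam ^+ 2 * (#|A|%:R * #|B|%:R).
Proof. by apply: expander_mixing => //; have := lam_d; have := lam0; lra. Qed.

(** Without edges the mixing bound compares the square of the main term with [lam ^+ 2 * p]; one
    factor [p] cancels. *)
Lemma no_edges_card A B : edges_between e A B = 0%N ->
  #|A|%:R * #|B|%:R <= (lam * n / d%:R) ^+ 2.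
Proof.
move=> e0; have := mixing A B; rewrite e0 sub0r sqrrN.
set p : R := #|A|%:R * #|B|%:R.
have p0 : 0 <= p by rewrite mulr_ge0 ?ler0n.
have [->|pn0] := eqVneq p 0; first by rewrite sqr_ge0.
have pgt : 0 < p by rewrite lt0r pn0.
rewrite exprMn [p ^+ 2]expr2 mulrA ler_pM2r // => H.
have -> : p = (d%:R / n) ^+ 2 * p * (n / d%:R) ^+ 2.
  by field; rewrite (gt_eqF n_gt0) (gt_eqF d_gt0).
have -> : (lam * n / d%:R) ^+ 2 = lam ^+ 2 * (n / d%:R) ^+ 2 by field; rewrite (gt_eqF d_gt0).
by rewrite ler_wpM2r // sqr_ge0.
Qed.

(** A single vertex has no loop, so [no_edges_card] applies to [[set v]] against itself. *)
Lemma lam_ge1 : 1 <= lam * n / d%:R.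
Proof.
have /card_gt0P[v _] : (0 < #|T|)%N by apply: ltnW.
have := @no_edges_card [set v] [set v]; rewrite cards1 mulr1 => H.
have q0 : 0 <= lam * n / d%:R by rewrite divr_ge0 ?mulr_ge0 ?lam0 ?ler0n.
rewrite -(@ler_pXn2r _ 2) ?nnegrE // expr1n; apply: H.
rewrite /edges_between big_set1; apply/eqP; rewrite cards_eq0; apply/eqP/setP => x.
by rewrite !inE; case: eqVneq => //= ->; case: ndl => _ ->.
Qed.

Lemma edge_exists A B : lam * n / d%:R < #|A|%:R -> lam * n / d%:R < #|B|%:R ->
  exists u v, [/\ u \in A, v \in B & e u v].
Proof.
move=> qA qB; have q1 := lam_ge1.
case: (pickP [pred u | (u \in A) && [exists v in B, e u v]]) => [u /andP[uA]|no].
  by case/exists_inP => v vB uv; exists u, v.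
have : edges_between e A B = 0%N.
  rewrite /edges_between big1 // => u uA; apply/eqP; rewrite cards_eq0.
  apply/eqP/setP => v; rewrite !inE; apply/negP => /andP[vB uv].
  by have /andP[] := no u; split=> //; apply/exists_inP; exists v.
by move/no_edges_card; rewrite leNgt expr2 ltr_pM // (le_trans ler01).
Qed.

Lemma degree_edges (delta : R) A N :
  (forall v, v \in A -> delta <= #|[set y in N | e v y]|%:R) ->
  delta * #|A|%:R <= (edges_between e A N)%:R.
Proof.
move=> deg; rewrite natr_sum -sum1_card natr_sum mulr_sumr.
by apply: ler_sum => v vA; rewrite mulr1 deg.
Qed.

(** If [#|N| < 8 * #|A|], the main term is at most [32 * lam * #|A|], while the degrees force
    [500 * lam * #|A|] edges. The excess [468 * lam * #|A|] is more than mixing permits. *)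
Lemma small_set_expansion A N :
  (forall v, v \in A -> 500 * lam <= #|[set y in N | e v y]|%:R) ->
  #|A|%:R <= 4 * (lam * n / d%:R) -> (8 * #|A| <= #|N|)%N.
Proof.
move=> /degree_edges deg cA; rewrite leqNgt; apply/negP => cN.
have := mixing A N; set E : R := (edges_between _ _ _)%:R in deg *.
set a : R := #|A|%:R in cA deg *; set t : R := #|N|%:R => mix.
have lt : t < 8 * a by rewrite /t /a -natrM ltr_nat.
have t0 : 0 <= t by rewrite ler0n.
have lamgt : 0 < lam.
  by rewrite lt0r lam0 andbT; apply: contraTneq lam_ge1 => ->; rewrite !mul0r ler10.
have da : d%:R / n * a <= 4 * lam.
  rewrite mulrAC ler_pdivrMr // -ler_pdivlMl //.
  apply: le_trans cA _; rewrite le_eqVlt; apply/orP; left; apply/eqP.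
  by field; rewrite (gt_eqF d_gt0).
have dat : d%:R / n * (a * t) <= 32 * lam * a.
  rewrite mulrA; apply: le_trans (ler_wpM2r t0 da) _.
  by have := ler_wpM2l (ltW lamgt) (ltW lt); lra.
have h : 468 * lam * a <= E - d%:R / n * (a * t) by lra.
have a0 : 0 < a by lra.
have : (468 * lam * a) ^+ 2 <= lam ^+ 2 * (a * t).
  apply: le_trans mix; rewrite ler_pXn2r ?nnegrE //; first by rewrite !mulr_ge0 // ltW.
  by apply: le_trans h; rewrite !mulr_ge0 // ltW.
apply/negP; rewrite -ltNge !exprMn.
have -> : 468 ^+ 2 * lam ^+ 2 * a ^+ 2 = lam ^+ 2 * (a * (468 ^+ 2 * a)) by ring.
rewrite ltr_pM2l ?exprn_gt0 // ltr_pM2l //; lra.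
Qed.

End Expansion.

(** * Numerical parameters *)

Lemma ln2_ge (R : realType) : 2^-1 <= ln (2 : R).
Proof.
have := @le_ln1Dx R (- 2^-1); have -> : 1 + - 2^-1 = 2^-1 :> R by lra.
by rewrite lnV ?posrE ?ltr0n // => H; have := H ltac:(lra); lra.
Qed.

Lemma ler_ln_nat (R : realType) (a b : nat) :
  (0 < a)%N -> (a <= b)%N -> ln (a%:R : R) <= ln (b%:R : R).
Proof.
move=> a0 ab; rewrite ler_ln ?posrE ?ltr0n ?ler_nat //.
exact: leq_trans ab.
Qed.

(** Here [m] is the least integer above [q], and [2 ^ k] the least power of two above [m]. Since
    [ln 2] is at least one half, [2 * k] is at most [6 * ln n], so the links use at most
    [6 * l / 100] cycles; [4 * 2 ^ k <= 8 * m] and [1000 * m <= l] leave ample room. *)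
Lemma linking_parameters (R : realType) (n l r : nat) (q : R) :
  1 <= q -> 2000 * q <= l%:R -> (4 <= n)%N -> (l <= n)%N ->
  r%:R <= l%:R / (100 * ln (n%:R : R)) ->
  exists m k M : nat, [/\ q < m%:R, m%:R <= 2 * q, (m < 2 ^ k)%N,
    (9 * m + M < l)%N & (2 * k * r + 4 * 2 ^ k <= M)%N].
Proof.
move=> q1 ql n4 l_n rl.
have /andP[] := truncn_itv (le_trans ler01 q1).
set m' := Num.truncn q => mq qm.
have [m mE] : exists m, m = m'.+1 by eexists.
have mR : m%:R = m'%:R + 1 :> R by rewrite mE -natr1.
have qm' : q < m%:R by rewrite mE.
have m2q : m%:R <= 2 * q by rewrite mR; lra.
have m0 : (0 < m)%N by rewrite mE.
have /andP[] := @trunc_log_bounds 2 m isT m0; set k := trunc_log 2 m => km mk.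
have lm : (1000 * m <= l)%N by rewrite -(ler_nat R) natrM; lra.
have ln2_half := ln2_ge R.
have L1 : 1 <= ln (n%:R : R).
  have := @ler_ln_nat R 4 n isT n4.
  have -> : 4%:R = 2 ^+ 2 :> R by rewrite -natrX.
  rewrite lnXn // mulr2n; lra.
have kL : k%:R * 2^-1 <= ln (n%:R : R).
  have mn : (2 ^ k <= n)%N.
    by apply: leq_trans km (leq_trans _ l_n); clear -lm; lia.
  have := @ler_ln_nat R (2 ^ k) n (expn_gt0 2 k) mn.
  rewrite natrX lnXn // -[ln 2 *+ k]mulr_natl => H; apply: le_trans H.
  by rewrite ler_wpM2l.
have krl : 100 * (2 * k.+1%:R * r%:R) <= 6 * l%:R :> R.
  have kr : 2 * k.+1%:R * r%:R <= 6 * ln (n%:R : R) * (l%:R / (100 * ln (n%:R : R))).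
    apply: ler_pM rl; rewrite ?mulr_ge0 //.
    by rewrite -natr1; lra.
  have e : 6 * ln (n%:R : R) * (l%:R / (100 * ln (n%:R : R))) = 6 * l%:R / 100.
    by field; lra.
  by rewrite e in kr; lra.
have krl' : (100 * (2 * k.+1 * r) <= 6 * l)%N by rewrite -(ler_nat R) !natrM; lra.
(* [M] is the largest value with [9 * m + M < l]. *)
exists m, k.+1, (l - 9 * m - 1)%N; split=> //; first by clear -lm m0; lia.
rewrite expnS; move: (2 * k.+1 * r)%N (2 ^ k)%N krl' km => x y; clear -lm m0; lia.
Qed.

(** * Deriving the theorem *)

Lemma uniq_map_flatten (T : eqType) (f : seq T -> T) (ps : seq (seq T)) :
  uniq (flatten ps) -> (forall p, p \in ps -> f p \in p) -> uniq (map f ps).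
Proof.
elim: ps => //= p ps IH; rewrite cat_uniq => /and3P[_ /hasPn dis ups] fin.
rewrite IH // => [|q qin]; last by apply: fin; rewrite inE qin orbT.
rewrite andbT; apply/mapP => -[q qin fpq].
have : f q \in flatten ps.
  by apply/flattenP; exists q => //; apply: fin; rewrite inE qin orbT.
by move/dis; rewrite /= -fpq fin ?mem_head.
Qed.

Theorem theorem7p2 (R : realType) :
  exists n0 : nat, forall (T : finType) (e : rel T) (d : nat) (lam : R)
    (l : nat) (Ps Cs : seq (seq T)),
    (n0 <= #|T|)%N ->
    ndl_graph e d lam ->
    lam < d%:R / 500 ->
    2000 * lam * #|T|%:R / d%:R <= l%:R ->
    good e (l%:R / (100 * ln (#|T|%:R : R))) l (500 * lam) Ps Cs ->
    hamiltonian (unionG e Ps Cs).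
Proof.
(* Four vertices give [1 <= ln n] and a cycle of length above two. *)
exists 4%N => T e d lam l Ps Cs n4 ndl lamd lq.
case=> P1 [Ps' [[-> szr szC ne] [[up uc _ dis cov] [X [conn degX degE]]]]].
have n1 : (1 < #|T|)%N by apply: leq_trans n4.
have /card_gt0P[x0 _] : (0 < #|T|)%N by apply: leq_trans n4.
have esym : symmetric e by case: ndl.
case: conn => F [szF flexF XE].
pose I := 'I_(size Cs).
have data (c : I) : exists t : T * T * T * seq T,
    [/\ exists i, rot i (nth [::] Cs c) = [:: t.1.1.1, t.1.1.2, t.1.2 & t.2],
        pedge P1 t.1.1.1 t.1.1.2,
        forall v, v \in nth [::] Cs c -> v \in P1 -> v = t.1.1.1 \/ v = t.1.1.2 &
        nth (x0, x0) F c = (last t.1.2 t.2, t.1.2)].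
  have zin : (nth [::] Cs c, nth (x0, x0) F c) \in zip Cs F.
    by rewrite -nth_zip // mem_nth // size_zip szF minnn.
  have [i [a [b [z [s [ri pe me xl yz]]]]]] := flexF _ zin.
  exists (a, b, z, s); split=> //=; first by exists i.
  by move: xl yz => /= <- <-; case: (nth _ F c).
have [t tP] := fin_all_exists data.
pose aa c := (t c).1.1.1; pose bb c := (t c).1.1.2.
pose zz c := (t c).1.2; pose ss c := (t c).2.
have rotC (c : I) : exists i, rot i (nth [::] Cs c) = [:: aa c, bb c, zz c & ss c].
  by case: (tP c).
have P1e c : pedge P1 (aa c) (bb c) by case: (tP c).
have P1m (c : I) v : v \in nth [::] Cs c -> v \in P1 -> v = aa c \/ v = bb c.
  by case: (tP c) => _ _ H _; apply: H.
have dis' v : v \in flatten Cs -> v \notin flatten Ps' by apply: dis.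
have XP v : reflect (exists c, flexible zz ss v c) (v \in X).
  rewrite XE inE; apply: (iffP (has_nthP (x0, x0))) => [[j jF]|[c]].
    rewrite szF in jF; pose c : I := Ordinal jF.
    have [_ _ _ Fc] := tP c; rewrite -[j]/(nat_of_ord c) Fc /= => h.
    by exists c; rewrite /flexible ![v == _]eq_sym.
  have [_ _ _ Fc] := tP c; rewrite /flexible ![v == _]eq_sym => h.
  by exists c; rewrite ?szF // Fc.
set g := cycle_nbr e zz ss; set st := far_end e zz ss; set own := flexible zz ss.
(* By goodness, [Y] contains the flexible vertices and the endpoints of all paths. *)
pose Y := [set v | 500 * lam <= #|[set y in X | e v y]|%:R].
have own_st v c : own (st v c) c.
  by rewrite /own /flexible /st /far_end; case: ifP; rewrite eqxx ?orbT.
have own_inj v c c' : own v c -> own v c' -> c = c'.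
  by move=> /flexible_detour vc /flexible_detour; apply: (detour_inj uc rotC).
have own_Y v c : own v c -> v \in Y.
  by move=> vc; rewrite inE; apply: degX; apply/XP; exists c.
have ex_inj : injective (exit_end zz ss).
  move=> c c' ecc; apply: (@own_inj (exit_end zz ss c)); first by rewrite /own /flexible eqxx.
  by rewrite /own /flexible ecc eqxx.
have q1 := lam_ge1 ndl n1 lamd; set q := lam * _ / _ in q1.
have lT : (l <= #|T|)%N by rewrite -szC -(card_ord (size Cs)) (leq_card _ ex_inj).
have [|m [k [M [qm m2q mk lM kM]]]] := linking_parameters q1 _ n4 lT szr.
  by move: lq; rewrite /q -!mulrA.
have m0 : (0 < m)%N by rewrite -(ltr_nat R); lra.
(* The flexible vertices of the cycles adjacent to [A] include all flexible neighbours of [A], hence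
   number at least [8 * #|A|]; each cycle accounts for at most two. *)
have nbr_small (A : {set T}) : A \subset Y -> (#|A| <= 2 * m)%N -> (4 * #|A| <= #|cnbr g A|)%N.
  move=> /subsetP sA cA; pose N := exit_end zz ss @: cnbr g A :|: zz @: cnbr g A.
  have cN : (8 * #|A| <= #|N|)%N.
    apply: (small_set_expansion ndl n1 lamd) => [v vA|]; last first.
      by move: cA; rewrite -(ler_nat R) natrM -/q; lra.
    have := sA v vA; rewrite inE => /le_trans -> //; rewrite ler_nat.
    apply/subset_leq_card/subsetP => y; rewrite !inE => /andP[/XP[c yc] evy].
    rewrite evy andbT; have cA' : c \in cnbr g A.
      rewrite inE; apply/exists_inP; exists v => //; rewrite /g /cycle_nbr.
      by case/orP: yc => /eqP<-; rewrite evy ?orbT.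
    by case/orP: yc => /eqP->; rewrite imset_f ?orbT.
  have N2 : (#|N| <= 2 * #|cnbr g A|)%N.
    rewrite mul2n -addnn; apply: leq_trans (leq_card_setU _ _) _.
    by apply: leq_add; apply: leq_imset_card.
  by move: (leq_trans cN N2); clear; lia.
(* Cycles not adjacent to [A] have distinct exit ends that send no edge to [A], so there are fewer
   than [m] of them, and [9 * m + M < l]. *)
have nbr_big (A : {set T}) : A \subset Y -> (m <= #|A|)%N -> (#|A| <= 2 * m)%N ->
    (8 * m + M < #|cnbr g A|)%N.
  move=> _ mA _; pose Z := exit_end zz ss @: ~: cnbr g A.
  have cZ : (#|Z| < m)%N.
    have e0 : edges_between e A Z = 0%N.
      rewrite /edges_between big1 // => v vA; apply/eqP; rewrite cards_eq0.
      apply/eqP/setP => y; rewrite !inE; apply/negP => /andP[/imsetP[c]].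
      rewrite !inE => /exists_inP nc -> evy; apply: nc; exists v => //.
      by rewrite /g /cycle_nbr evy.
    have := no_edges_card ndl n1 lamd e0; rewrite -/q -(ltr_nat R).
    apply: contraTT; rewrite -leNgt -ltNge => mZ; rewrite expr2.
    have qA : q < #|A|%:R by apply: lt_le_trans qm _; rewrite ler_nat.
    by apply: ltr_pM => //; [lra | lra | apply: lt_le_trans mZ].
  have := cardsC (cnbr g A); rewrite card_ord [X in _ = X]szC -[#|~: _|](card_imset _ ex_inj) -/Z.
  by clear -cZ lM; lia.
have dense (A B : {set T}) : A \subset Y -> B \subset Y ->
    (m < #|A|)%N -> (m < #|B|)%N -> exists u v, [/\ u \in A, v \in B & e u v].
  move=> _ _ mA mB; apply: (edge_exists ndl n1 lamd); apply: (lt_trans qm);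
    by rewrite ltr_nat.
have end_terminal p v : p \in P1 :: Ps' -> v = head x0 p \/ v = last x0 p ->
    v \in p /\ terminal Y own v.
  move=> pin vp; have pne : p != [::] by apply: (allP ne).
  have vin : v \in p.
    by case: p pne vp {pin} => // x s _ [] ->; rewrite /= ?mem_head ?mem_last.
  split=> //; split.
    rewrite inE; apply: (degE p pin) => //.
    by case: p pne vp {pin vin} => // x s _ [] ->; rewrite /= eqxx ?orbT.
  move=> c; apply/negP => /flexible_detour.
  move/(detour_notin_paths uc dis' rotC P1m)/negP; apply.
  by apply/flattenP; exists p.
set js := junctions x0 (P1 :: Ps') (head x0 P1).
have js1 : map fst js = map (last x0) (P1 :: Ps') by apply: junctions_fst.
have js2 : perm_eq (map snd js) (map (head x0) (P1 :: Ps')).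
  by rewrite junctions_snd perm_rcons.
have [|||qs [lqs uqs]] := linking m0 nbr_big own_st own_inj own_Y dense mk (prs := js) nbr_small.
- move=> j jin; split.
    have : j.1 \in map fst js by apply: map_f.
    by rewrite js1 => /mapP[p pin ->]; apply: (end_terminal p _ pin _).2; right.
  have : j.2 \in map snd js by apply: map_f.
  by rewrite (perm_mem js2) => /mapP[p pin ->]; apply: (end_terminal p _ pin _).2; left.
(* The paths are disjoint, so a vertex is the last of at most one path and the head of at most
   one. *)
- move=> z; rewrite -(count_map fst (pred1 z)) -(count_map snd (pred1 z)) js1.
  rewrite (permP js2); apply: (@leq_add _ _ 1 1); rewrite count_uniq_mem ?leq_b1 //;
    apply: uniq_map_flatten => // p pin.
    by apply: (end_terminal p _ pin _).1; right.
  by apply: (end_terminal p _ pin _).1; left.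
- by rewrite size_junctions.
by apply: (hamiltonian_assemble esym ne up uc dis' cov rotC P1e P1m _ lqs uqs);
  apply: leq_trans n4.
Qed.
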